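(* Let $X$ be the compact metric graph, $B$ the nonempty set of degree-one vertices, $D=X\setminus B$ (assumed connected), $x_0\in D$, and let $(D_n)$ be the exhaustion with cut points $b_n$ ($b\in B$) described in the context. Let $u>0$ be harmonic on $D$, let $D^G$ be a compact metrizable compactification of $D$, and set $\widehat D=D^G\vee X$ with projection $p_K:\widehat D\to X$. Put $\lambda_n:=u\,\omega_{x_0}^{D_n}$. Then: 1. The measures $\lambda_n$ have weakly convergent subsequences on $\widehat D$. Every limit $\widehat\mu_u$ is carried by $p_K^{-1}(B)$ and gives $$u(x)=\int_{p_K^{-1}(B)}K_D(x,p_K(\widehat\eta))\,d\widehat\mu_u(\widehat\eta)\quad(x\in D),\qquad\widehat\mu_u(\widehat D)=u(x_0).$$ For $\widehat\mu_u$-almost every $\widehat\eta$ there are $n_j\uparrow\infty$ and $y_j\in\partial D_{n_j}$ such that $y_j\to\widehat\eta$ in $\widehat D$ and $K_{D_{n_j}}(\cdot,y_j)\to K_D(\cdot,p_K(\widehat\eta))$ locally uniformly in $D$. 2. The push-forward $\mu_u=(p_K)_\#\widehat\mu_u$ is the unique finite positive measure on $B$ representing $u$ through $K_D$, it is independent of the chosen weakly convergent subsequence, and explicitly $$u(x)=\int_BK_D(x,b)\,d\mu_u(b),\qquad\mu_u=\sum_{b\in B}u(b)H_b(x_0)\,\delta_b,\qquad\mu_u(B)=u(x_0),$$ where $u(b)$ denotes the continuous endpoint value of $u$ at $b$. 3. $\lambda_n\Longrightarrow\mu_u$ weakly on $X$, and $u(x)=\int_{\partial D_n}K_{D_n}(x,y)\,d\lambda_n(y)$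 for $x\in D_n$. 4. For every $b\in B$, $b_n\to b$ and $K_{D_n}(\cdot,b_n)\to K_D(\cdot,b)$ locally uniformly in $D$. Moreover, for every fixed $x\in D$ there is a positive $f_x\in C(X)$ with $f_x(b_n)=K_{D_n}(x,b_n)$ for all sufficiently large $n$ and $f_x(b)=K_D(x,b)$; the function $\widehat f_x=f_x\circ p_K\in C(\widehat D)$ is positive, satisfies $\widehat f_x(b_n)=K_{D_n}(x,b_n)$ for all sufficiently large $n$, and equals $K_D(x,b)$ on $p_K^{-1}(b)$.
   Context: Let $G=(V,E)$ be a finite connected graph with positive symmetric edge weights $\mu_e$. Realize each edge $e$ as an interval of length $\ell_e=1/\mu_e$ and identify endpoints according to $G$; the resulting compact metric graph $X$ carries its path metric. A function is harmonic on an open subset of $X$ if it is continuous, affine on each edge segment, and satisfies at every vertex $v$ of the open set the Kirchhoff condition $\sum_{e\sim v}\partial_eu(v)=0$, where $\partial_eu(v)$ is the derivative along $e$ directed away from $v$ and incident edge ends are counted separately. For a connected open $U\subset X$ with finite nonempty boundary, every $f:\partial U\to\mathbb R$ has a unique continuous extension to $\overline U$ harmonic in $U$; $H_b^U$ denotes the one with boundary values $\chi_{\{b\}}$, and $\omega_x^U=\sum_{b\in\partial U}H_b^U(x)\delta_b$ is the harmonic measure. $B$ is a nonempty set of degree-one vertices of $X$ with $D=X\setminus B$ connected, and $x_0\in D$ is fixed. $H_b=H_b^D$, $K_D(x,b)=H_b(x)/H_b(x_0)$ for $b\in B$. Every nonnegative harmonic function on $D$ extends continuously to $X$. Choose pairwise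 disjoint terminal edge segments incident with the points of $B$, avoiding $x_0$ and all other vertices, and a strictly decreasing sequence $\varepsilon_n\downarrow0$ with $\varepsilon_n$ smaller than all their lengths. $D_n$ is the open set obtained from $X$ by deleting, for each $b\in B$, the closed segment of length $\varepsilon_n$ at $b$; $b_n$ is the cut point on the edge incident with $b$, so $\partial D_n=\{b_n:b\in B\}$. $K_{D_n}(x,y)=\frac{d\omega_x^{D_n}}{d\omega_{x_0}^{D_n}}(y)$. A compactification of $D$ is a compact Hausdorff space containing $D$ as a dense subspace; $X$ is one. $D^G\vee X=\overline{\{(x,x):x\in D\}}\subseteq D^G\times X$, with $D$ identified with its diagonal image, and $p_K$ is the projection to the second coordinate. Measures on $\partial D_n$ are regarded as measures on $X$ or $\widehat D$ via $\partial D_n\subset D$; $\Longrightarrow$ is weak convergence against continuous functions; a measure is carried by a Borel set if the complement has measure zero. *)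

(* Defs.v *)
From HB Require Import structures.
From mathcomp Require Import all_boot all_order all_algebra.
From mathcomp Require Import all_classical all_reals all_analysis.

Set Implicit Arguments.
Unset Strict Implicit.
Unset Printing Implicit Defensive.

Import Order.TTheory GRing.Theory Num.Theory.
Import numFieldNormedType.Exports.

Local Open Scope classical_set_scope.
Local Open Scope ring_scope.

(* An unoriented edge is stored with an arbitrary orientation [esrc -> etgt],
   so the symmetry of the weights is built in; loops and multiple edges are
   allowed. *)
Record wgraph (R : realType) := WGraph {
  vertex : finType ;
  edge : finType ;
  esrc : edge -> vertex ;
  etgt : edge -> vertex ;
  weight : edge -> R ;
  weight_gt0 : forall e, 0 < weight e ;
  wgraph_connected : forall v w : vertex,
    connect (fun v w => [exists e,
      ((esrc e == v) && (etgt e == w)) || ((esrc e == w) && (etgt e == v))])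
      v w }.

Section MetricGraph.
Context {R : realType} (G : wgraph R).

Definition elen (e : edge G) : R := (weight e)^-1.

Lemma elen_gt0 e : 0 < elen e.
Proof. by rewrite invr_gt0 weight_gt0. Qed.

(* The quotient of the disjoint union of the intervals [0, elen e] is
   represented by its normal forms: a vertex, or an interior point of an
   edge.  [pt e] below is the quotient map restricted to the edge [e]. *)
Inductive mgraph : Type :=
| Vtx of vertex G
| Inner (e : edge G) (t : R) of 0 < t < elen e.

HB.instance Definition _ := gen_eqMixin mgraph.
HB.instance Definition _ := gen_choiceMixin mgraph.

(* [t] is the distance from [esrc e]; it is clamped to [0, elen e]. *)
Definition pt (e : edge G) (t : R) : mgraph :=
  match boolP (0 < t < elen e) with
  | AltTrue h => Inner h
  | AltFalse _ => if t <= 0 then Vtx (esrc e) else Vtx (etgt e)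
  end.

(* [path_length x y r]: a piecewise affine path of length [r] joins [x] to
   [y]; each of its finitely many pieces runs along a single edge. *)
Inductive path_length : mgraph -> mgraph -> R -> Prop :=
| PathNil x : path_length x x 0
| PathCons e s t y r : 0 <= s <= elen e -> 0 <= t <= elen e ->
    path_length (pt e t) y r ->
    path_length (pt e s) y (`|s - t| + r).

(* The ball of the path metric, which is the infimum of the path lengths. *)
Definition path_ball (x : mgraph) (eps : R) : set mgraph :=
  [set y | exists2 r, path_length x y r & r < eps].

Let path_ball_center x (eps : R) : 0 < eps -> path_ball x eps x.
Proof. by move=> eps0; exists 0 => //; exact: PathNil. Qed.

Let path_length_cat x y z r r' :
  path_length x y r -> path_length y z r' -> path_length x z (r + r').
Proof.
elim=> [a|e s t b q hs ht _ IH] h; first by rewrite add0r.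
by rewrite -addrA; apply: PathCons => //; exact: IH.
Qed.

Let path_length_rev x y r : path_length x y r -> path_length y x r.
Proof.
elim=> [a|e s t b q hs ht _ IH]; first exact: PathNil.
rewrite addrC distrC; apply: (path_length_cat IH); rewrite -[`|_|]addr0.
by apply: PathCons => //; exact: PathNil.
Qed.

Let path_ball_sym x y (eps : R) : path_ball x eps y -> path_ball y eps x.
Proof. by move=> [r /path_length_rev h re]; exists r. Qed.

Let path_ball_triangle x y z (e1 e2 : R) :
  path_ball x e1 y -> path_ball y e2 z -> path_ball x (e1 + e2) z.
Proof.
move=> [r1 h1 l1] [r2 h2 l2]; exists (r1 + r2); last by rewrite ltrD.
exact: path_length_cat h1 h2.
Qed.

Let ent : set_system (mgraph * mgraph) := entourage_ path_ball.
Let nbhs_mgraph (x : mgraph) : set_system mgraph := nbhs_ ent x.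
Let nbhs_mgraphE : nbhs_mgraph = nbhs_ ent. Proof. by []. Qed.
Let entE : ent = entourage_ path_ball. Proof. by []. Qed.

HB.instance Definition _ := hasNbhs.Build mgraph nbhs_mgraph.
HB.instance Definition _ := @Nbhs_isPseudoMetric.Build R mgraph
  ent nbhs_mgraphE path_ball path_ball_center path_ball_sym
  path_ball_triangle entE.

(* The end [(e, false)] sits at [esrc e] and [(e, true)] at [etgt e], so a
   loop has two ends at the same vertex. *)
Local Notation edge_end := (edge G * bool)%type.

Definition end_vtx (a : edge_end) : vertex G :=
  if a.2 then etgt a.1 else esrc a.1.

(* The point at distance [t] from the end [a] on its edge. *)
Definition end_pt (a : edge_end) (t : R) : mgraph :=
  pt a.1 (if a.2 then elen a.1 - t else t).

Definition degree (v : vertex G) : nat :=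
  #|[set a : edge_end | end_vtx a == v]%SET|.

(* Meant for a vertex [v] of degree one, where [pick] has only one choice. *)
Definition cut_pt (v : vertex G) (t : R) : mgraph :=
  if [pick a : edge_end | end_vtx a == v] is Some a then end_pt a t else Vtx v.

Definition terminal_seg (v : vertex G) (t : R) : set mgraph :=
  [set cut_pt v r | r in [set r : R | 0 <= r <= t]].

(* Derivative at the vertex along an edge end, directed away from it. *)
Definition end_deriv (u : mgraph -> R) (a : edge_end) : R :=
  lim (r^-1 * (u (end_pt a r) - u (end_pt a 0)) @[r --> 0^'+]).

Definition edge_affine (U : set mgraph) (u : mgraph -> R) : Prop :=
  forall (e : edge G) (s t : R), 0 <= s -> s <= t -> t <= elen e ->
    (forall r, s <= r <= t -> U (pt e r)) ->
    exists p q : R, forall r, s <= r <= t -> u (pt e r) = p * r + q.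

Definition harmonic_on (U : set mgraph) (u : mgraph -> R) : Prop :=
  [/\ {within U, continuous u},
      edge_affine U u &
      forall v, U (Vtx v) -> \sum_(a : edge_end | end_vtx a == v)
        end_deriv u a = 0].

Definition boundary (U : set mgraph) : set mgraph := closure U `\` interior U.

(* The vanishing outside [closure U] only normalizes the solution as a
   function on the whole graph. *)
Definition dirichlet_solution (U : set mgraph) (f h : mgraph -> R) : Prop :=
  [/\ {within closure U, continuous h},
      harmonic_on U h,
      (forall y, boundary U y -> h y = f y) &
      (forall y, ~ closure U y -> h y = 0)].

Definition harmonic_extension (U : set mgraph) (f : mgraph -> R) :
  mgraph -> R := xget (cst 0) [set h | dirichlet_solution U f h].

(* [harm U b] is $H_b^U$. *)
Definition harm (U : set mgraph) (b : mgraph) : mgraph -> R :=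
  harmonic_extension U (\1_[set b]).

(* $K_D(x,b)$, for the base point [x0]. *)
Definition martin_kernel (D : set mgraph) (x0 x b : mgraph) : R :=
  harm D b x / harm D b x0.

End MetricGraph.

(* Measurable types have to be pointed: [Borel p] is the space of [p] with
   its Borel sigma-algebra, pointed at [p]. *)
Definition at_point (T : choiceType) (p : T) : Type := T.
HB.instance Definition _ (T : choiceType) (p : T) :=
  Choice.on (at_point p).
HB.instance Definition _ (T : choiceType) (p : T) :=
  isPointed.Build (at_point p) p.

Notation Borel p :=
  (g_sigma_algebraType (open : set (set (at_point p)))).

Section Measures.
Context {R : realType} {T : topologicalType} {p : T}.
Local Open Scope ereal_scope.

(* A set function that is a finite measure, packed as such. *)
Definition to_finite_measure (m : set (Borel p) -> \bar R) :
    {finite_measure set (Borel p) -> \bar R} :=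
  if pselect (exists mu : {finite_measure set (Borel p) -> \bar R},
       forall A, measurable A -> mu A = m A) is left h
  then projT1 (cid h) else mzero.

Definition weak_cvg (m_ : nat -> set (Borel p) -> \bar R)
    (m : set (Borel p) -> \bar R) : Prop :=
  forall f : T -> R, continuous f ->
    \int[m_ n]_x (f x)%:E @[n --> \oo] --> \int[m]_x (f x)%:E.

Definition subseq_weak_limit (m_ : nat -> set (Borel p) -> \bar R)
    (m : set (Borel p) -> \bar R) : Prop :=
  exists2 phi : nat -> nat, {homo phi : i j / (i < j)%N} &
    weak_cvg (m_ \o phi) m.

End Measures.

Section HarmonicMeasure.
Context {R : realType} {G : wgraph R} (x0 : mgraph G).
Local Open Scope ereal_scope.

Definition harmonic_measure (U : set (mgraph G)) (x : mgraph G)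
    (A : set (Borel x0)) : \bar R :=
  \sum_(b \in boundary U) (harm U b x)%:E * \d_(b : Borel x0) A.

(* $K_U(x,y) = d\omega_x^U / d\omega_{x_0}^U (y)$ *)
Definition poisson_kernel (U : set (mgraph G)) (x y : mgraph G) : R :=
  fine (Radon_Nikodym
    (charge_of_finite_measure (to_finite_measure (harmonic_measure U x)))
    (to_finite_measure (harmonic_measure U x0)) y).

(* The measure $u\,\omega_{x_0}^U$. *)
Definition weighted_harmonic_measure (u : mgraph G -> R) (U : set (mgraph G))
    (A : set (Borel x0)) : \bar R :=
  \int[harmonic_measure U x0]_(y in A) (u y)%:E.

End HarmonicMeasure.

Definition metrizable (R : realType) (T : topologicalType) : Prop :=
  exists d : T -> T -> R,
    [/\ forall x y, d x y = 0 <-> x = y,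
        forall x y, d x y = d y x,
        forall x y z, d x z <= d x y + d y z &
        forall x (A : set T), nbhs x A <->
          exists2 e : R, 0 < e & [set y | d x y < e] `<=` A].

Definition compactification (D K : topologicalType) (i : D -> K) : Prop :=
  [/\ compact [set: K], hausdorff_space K,
      injective i /\
        (forall A : set D, open A <-> exists2 B, open B & i @^-1` B = A) &
      dense (range i)].

(* The join of two compactifications [i] and [k] of [D]. *)
Definition cjoin_set (D K X : topologicalType) (i : D -> K) (k : D -> X) :
  set (K * X) := closure (range (fun x => (i x, k x))).

Definition cjoin (D K X : topologicalType) (i : D -> K) (k : D -> X) :
  topologicalType := set_type (cjoin_set i k).

Section Join.
Context {D K X : topologicalType} (i : D -> K) (k : D -> X).

Lemma cjoin_emb_subproof x : (i x, k x) \in cjoin_set i k.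
Proof. by apply/mem_set/subset_closure; exists x. Qed.

Definition cjoin_emb (x : D) : cjoin i k :=
  exist _ (i x, k x) (cjoin_emb_subproof x).

Definition cjoin_proj (z : cjoin i k) : X := (\val z).2.

End Join.

(* A measure on [X] carried by [D], regarded as a measure on a space [T] that
   contains [D] through [j]. *)
Definition transport (R : realType) (X T : Type) (D : set X) (j : D -> T)
    (m : set X -> \bar R) (A : set T) : \bar R :=
  m [set \val z | z in j @^-1` A].

Section Domain.
Context {R : realType} {G : wgraph R} (B : {set vertex G}).

Definition ideal_pts : set (mgraph G) := [set Vtx b | b in [set` B]].

Definition domain : set (mgraph G) := ~` ideal_pts.

Definition exhaustion (eps : R) : set (mgraph G) :=
  ~` \bigcup_(b in [set` B]) terminal_seg b eps.

(* The continuous endpoint value of [u] at [b]. *)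
Definition endpoint_value (u : mgraph G -> R) (b : vertex G) : R :=
  lim (u @ within domain (nbhs (Vtx b))).

Definition loc_unif_cvg (f_ : nat -> mgraph G -> R) (f : mgraph G -> R) :=
  forall x, domain x -> exists2 N : set (mgraph G), nbhs x N &
    {uniform N `&` domain, f_ n @[n --> \oo] --> f}.

End Domain.

(* Main.v *)
Require Import Defs.
From HB Require Import structures.
From mathcomp Require Import all_boot all_order all_algebra.
From mathcomp Require Import all_classical all_reals all_analysis.
From mathcomp Require Import measurable_realfun.
From mathcomp Require Import lra ring.

(** Write $D_t$ for [X] without the closed segments of length [t] at the points
    of [B].  Then $D = D_0$ and $D_n = D_{\varepsilon_n}$ belong to one family,
    and all of them are treated at once.

    A harmonic function on $D_t$ is affine on each edge, so it is determined by
    its values at the vertices outside [B] and at the cut points, and Kirchhoff's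
    condition becomes a discrete Dirichlet problem on the same finite graph, with
    the inverse of the remaining length of an edge as its weight.  The minimum
    principle ([discrete_min_principle]) makes this problem uniquely solvable
    ([discrete_dirichlet]).  Hence $H_b^{D_t}$ exists ([pole]), and a function [w]
    that is harmonic in $D_t$ and continuous up to the boundary satisfies the
    Poisson formula $w = \sum_b w(b_t) H_b^{D_t}$ ([poisson_formula]).  Points of
    [B] have degree one, so removing them does not disconnect the graph, and a
    zero of $H_b^{D_t}$ inside $D_t$ would spread everywhere: it is positive there
    ([pole_gt0]).

    The behaviour as $n \to \infty$ follows from this formula alone.  On the
    terminal edge at [c] the function $H_b^{D_t}$ is affine with values in
    $[0, 1]$, so for $t < t'$ its value at $c_{t'}$ differs from its value
    $\delta_{bc}$ at $c_t$ by $O(t' - t)$.  The Poisson formula on $D_{t'}$ then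
    gives $|H_b^{D_t} - H_b^{D_{t'}}| = O(t' - t)$ uniformly on $D_{t'}$
    ([pole_lipschitz]).  With $t = 0$ this is the locally uniform convergence of
    the kernels; for general [t] it says that the kernel is a Lipschitz function
    of the cut length, whence the function $f_x$ ([pole_ratio_extension]).
    Letting $n \to \infty$ in $u = \sum_b u(b_n) H_b^{D_n}$ gives
    $u = \sum_b u(b) H_b$ ([harmonic_representation]); the coefficients are
    recovered by approaching the points of [B], whence the uniqueness.

    All the measures are finite sums of point masses: $\lambda_n$ has mass
    $u(b_n) H_b^{D_n}(x_0)$ at $b_n$, and $K_{D_n}(x, b_n)$ is the ratio of two
    masses ([Radon_Nikodym_atom]).  These masses converge to $u(b) H_b(x_0)$, and
    $b_n \to b$ in [X].  In the join, the points $b_n$ converge along a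
    subsequence common to all [b], to points $\hat\eta_b$ over [b]
    ([join_limit_points]); so a weak limit of the $\lambda_n$ integrates
    continuous functions like $\sum_b u(b) H_b(x_0) \delta_{\hat\eta_b}$, and it
    is this measure since its atoms are zero sets of continuous functions
    ([atomic_weak_limit]).  What remains are identities between finite sums. *)

Set Implicit Arguments.
Unset Strict Implicit.
Unset Printing Implicit Defensive.

Import Order.TTheory GRing.Theory Num.Theory.
Import numFieldNormedType.Exports.

Local Open Scope classical_set_scope.
Local Open Scope ring_scope.

(** * The discrete Dirichlet problem *)

Section DiscreteDirichlet.
Context {R : realType} (G : wgraph R) (B : {set vertex G}).
Local Notation edge_end := (edge G * bool)%type.

Definition opp_end (a : edge_end) : edge_end := (a.1, ~~ a.2).

Lemma opp_endK : involutive opp_end.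
Proof. by case=> e b; rewrite /opp_end negbK. Qed.

(** Connectedness of the graph in the form used below: whatever spreads along
    edges spreads everywhere. *)
Lemma connected_closed (S : pred (vertex G)) v :
  (forall a, S (end_vtx a) -> S (end_vtx (opp_end a))) -> S v -> forall w, S w.
Proof.
move=> Sstep Sv w; have /connectP[p + ->] := wgraph_connected v w.
elim: p v Sv => [|x p IH] v Sv //= /andP[/existsP[e +] xp].
case/orP => /andP[/eqP ev /eqP ex]; apply: IH xp.
  by rewrite -ex; apply: (Sstep (e, false)); rewrite /end_vtx /= ev.
by rewrite -ev; apply: (Sstep (e, true)); rewrite /end_vtx /= ex.
Qed.

Variable c : edge G -> R.
Hypothesis c_gt0 : forall e, 0 < c e.

Definition flow (phi : vertex G -> R) (v : vertex G) : R :=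
  \sum_(a : edge_end | end_vtx a == v)
    c a.1 * (phi (end_vtx (opp_end a)) - phi v).

Definition discrete_harmonic (phi : vertex G -> R) :=
  forall v, v \notin B -> flow phi v = 0.

(** The flow out of a minimum is a sum of nonnegative terms, so it vanishes
    only if every term does. *)
Lemma flow0_argmin phi v : flow phi v = 0 -> (forall w, phi v <= phi w) ->
  forall a, end_vtx a = v -> phi (end_vtx (opp_end a)) = phi v.
Proof.
move=> fl0 vmin a av; apply/eqP; rewrite -subr_eq0.
have H : forall a' : edge_end, end_vtx a' == v ->
    0 <= c a'.1 * (phi (end_vtx (opp_end a')) - phi v).
  by move=> a' _; rewrite mulr_ge0 ?subr_ge0// ltW.
have /psumr_eq0P := H => /(_ fl0 a) /=; rewrite av => /(_ (eqxx _)) /eqP.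
by rewrite mulf_eq0 gt_eqF//.
Qed.

Hypothesis B_neq0 : B != finset.set0.

(** If the minimum were negative it would be attained off [B] only, and the
    vertices where it is attained would be closed under adjacency. *)
Lemma discrete_min_principle phi : discrete_harmonic phi ->
  (forall b, b \in B -> 0 <= phi b) -> forall v, 0 <= phi v.
Proof.
move=> phiH phiB v0.
pose m := [arg min_(v < v0) phi v]%O.
have mmin w : phi m <= phi w by rewrite /m; case: arg_minP => // i _; apply.
apply: le_trans (mmin v0); rewrite leNgt; apply/negP => mlt.
have [b bB] := set0Pn _ B_neq0.
suff /(_ b)/eqP bm : forall w, phi w == phi m by rewrite -bm ltNge phiB in mlt.
apply: (@connected_closed [pred w | phi w == phi m] m) => [a /eqP am|] /=; last first.
  by rewrite eqxx.
have aB : end_vtx a \notin B.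
  by apply: contraTN mlt => /phiB; rewrite am -leNgt.
by rewrite -am; apply/eqP/flow0_argmin => //; [exact: phiH|move=> w; rewrite am].
Qed.

Lemma flowB phi psi v : flow (fun w => phi w - psi w) v = flow phi v - flow psi v.
Proof.
rewrite /flow -sumrB; apply: eq_bigr => a _; rewrite -mulrBr; congr (_ * _).
by ring.
Qed.

Lemma discrete_uniq phi psi : discrete_harmonic phi -> discrete_harmonic psi ->
  (forall b, b \in B -> phi b = psi b) -> phi =1 psi.
Proof.
move=> phiH psiH e v; apply/le_anti; rewrite -subr_ge0 -[X in _ && X]subr_ge0.
apply/andP; split.
  apply: (@discrete_min_principle (fun w => psi w - phi w)) => [w wB|b bB].
    by rewrite flowB phiH ?psiH ?subrr.
  by rewrite e// subrr.
apply: (@discrete_min_principle (fun w => phi w - psi w)) => [w wB|b bB].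
  by rewrite flowB phiH ?psiH ?subrr.
by rewrite e// subrr.
Qed.

(** A zero off [B] spreads to all neighbours.  To spread through the whole
    graph it must also pass the vertices of [B], where no equation holds; but
    these have a single neighbour, so a zero that reaches one of them came from
    that neighbour, and remembering this closes the set [S]. *)
Lemma discrete_strong_min_principle phi :
  (forall b, b \in B -> degree b = 1%N) -> discrete_harmonic phi ->
  (forall b, b \in B -> 0 <= phi b) ->
  forall v, v \notin B -> phi v = 0 -> forall w, phi w = 0.
Proof.
move=> degB phiH phiB v vB v0.
have phi0 := discrete_min_principle phiH phiB.
pose S w := (phi w == 0) && ((w \in B) ==> [forall a, (end_vtx a == w) ==>
   ((end_vtx (opp_end a) \notin B) && (phi (end_vtx (opp_end a)) == 0))]).
suff H w : S w by move=> w; have /andP[/eqP] := H w.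
apply: (@connected_closed S v) => [a /andP[/eqP a0 /implyP aB]|]; last first.
  by rewrite /S v0 eqxx (negbTE vB).
have [aB'|aB'] := boolP (end_vtx a \in B).
  have /forallP/(_ a) := aB aB'; rewrite eqxx /= => /andP[oB o0].
  by rewrite /S o0 (negbTE oB).
have o0 : phi (end_vtx (opp_end a)) = 0.
  rewrite -a0; apply: flow0_argmin => //; first exact: phiH.
  by move=> u; rewrite a0.
rewrite /S o0 eqxx /=; apply/implyP => oB; apply/forallP => a'; apply/implyP => a'o.
have /eqP/cards1P [x Ex] := degB _ oB.
have : a' = opp_end a.
  have := a'o; have := eqxx (end_vtx (opp_end a)).
  have E z : (end_vtx z == end_vtx (opp_end a)) = (z == x).
    by move/setP/(_ z): Ex; rewrite !inE.
  by rewrite !E => /eqP -> /eqP ->.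
by move=> ->; rewrite opp_endK aB' a0 eqxx.
Qed.

(** The operator [A] keeps the values on [B] and takes the flow elsewhere; the
    minimum principle makes it injective, hence bijective, on the finite
    dimensional space of functions on the vertices. *)
Lemma discrete_dirichlet (f : vertex G -> R) : exists2 phi,
  discrete_harmonic phi & forall b, b \in B -> phi b = f b.
Proof.
pose A (phi : {ffun vertex G -> R^o}) : {ffun vertex G -> R^o} :=
  [ffun v => if v \in B then phi v else flow phi v].
have Alin : linear A.
  move=> k x y; apply/ffunP => v; rewrite !ffunE; case: ifP => // vB.
  rewrite /flow scaler_sumr -big_split /=; apply: eq_bigr => a _.
  rewrite !ffunE /GRing.scale /=; ring.
pose Al := GRing.isLinear.Build _ _ _ _ A Alin.
pose AL : {linear {ffun vertex G -> R^o} -> {ffun vertex G -> R^o}} := HB.pack A Al.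
have inj : lker (linfun AL) == 0%VS.
  apply/lker0P => x y; rewrite !lfunE /= => /ffunP e; apply/ffunP => v.
  have {}e w : A x w = A y w by exact: e.
  apply/eqP; rewrite -subr_eq0; apply/eqP.
  apply: (@discrete_uniq (fun v => x v - y v) (fun=> 0)) => [w wB|w _|b bB].
  - rewrite flowB; have := e w; rewrite !ffunE (negbTE wB) => ->.
    by rewrite subrr.
  - by rewrite /flow big1// => a _; rewrite subrr mulr0.
  - by have := e b; rewrite !ffunE bB => ->; rewrite subrr.
pose phi := (linfun AL)^-1%VF [ffun v => if v \in B then f v else 0].
have phiE v : A phi v = if v \in B then f v else 0.
  have : linfun AL phi = [ffun v => if v \in B then f v else 0].
    exact: lker0_lfunVK.
  by rewrite lfunE /= => /ffunP/(_ v) ->; rewrite ffunE.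
exists phi => [v vB|b bB]; first by have := phiE v; rewrite ffunE (negbTE vB).
by have := phiE b; rewrite ffunE bB.
Qed.

End DiscreteDirichlet.

(** * Points and paths of the metric graph *)

Section Points.
Context {R : realType} (G : wgraph R).
Local Notation edge_end := (edge G * bool)%type.
Implicit Types (e : edge G) (a : edge_end) (x : mgraph G).

Lemma pt_cases e t : (exists h : 0 < t < elen e, pt e t = Inner h) \/
  ~~ (0 < t < elen e) /\
    pt e t = if t <= 0 then Vtx (esrc e) else Vtx (etgt e).
Proof.
rewrite /pt.
exact: match boolP (0 < t < elen e) as z in alt_spec _ _ b' return
  (exists h, match z with AltTrue h => Inner h | AltFalse _ => _ end = Inner h)
  \/ _ /\ match z with AltTrue h => Inner h | AltFalse _ => _ end = _
with
| AltTrue h => or_introl (ex_intro _ h erefl)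
| AltFalse h => or_intror (conj h erefl)
end.
Qed.

Lemma pt_src e t : t <= 0 -> pt e t = Vtx (esrc e).
Proof.
move=> t0; have [[h _]|[_ ->]] := pt_cases e t; last by rewrite t0.
by case/andP: h => /(le_lt_trans t0); rewrite ltxx.
Qed.

Lemma pt_tgt e t : elen e <= t -> pt e t = Vtx (etgt e).
Proof.
move=> t0; have [[h _]|[_ ->]] := pt_cases e t.
  by case/andP: h => _ /(le_lt_trans t0); rewrite ltxx.
by rewrite leNgt (lt_le_trans (elen_gt0 e) t0).
Qed.

Lemma pt_inner e t (h : 0 < t < elen e) : pt e t = Inner h.
Proof.
have [[h' ->]|[/negP//]] := pt_cases e t.
by rewrite (bool_irrelevance h' h).
Qed.

Lemma end_pt0 a : end_pt a 0 = Vtx (end_vtx a).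
Proof.
rewrite /end_pt /end_vtx; case: ifP => _; first by rewrite subr0 pt_tgt.
by rewrite pt_src.
Qed.

Lemma end_pt_opp a r : end_pt (opp_end a) r = end_pt a (elen a.1 - r).
Proof. by rewrite /end_pt /=; case: a.2 => //=; congr pt; ring. Qed.

Lemma mgraph_case (P : mgraph G -> Prop) :
  (forall v, P (Vtx v)) ->
  (forall e t, 0 < t < elen e -> P (pt e t)) -> forall x, P x.
Proof. by move=> Pv Pe [v|e t h]; [exact: Pv|rewrite -pt_inner; exact: Pe]. Qed.

Lemma path_ball_pt e (r t d : R) : 0 <= r <= elen e -> 0 <= t <= elen e ->
  `|r - t| < d -> path_ball (pt e r) d (pt e t).
Proof.
move=> hr ht d0; exists (`|r - t| + 0); last by rewrite addr0.
by apply: PathCons => //; exact: PathNil.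
Qed.

Lemma end_coord a r : 0 <= r <= elen a.1 ->
  0 <= (if a.2 then elen a.1 - r else r) <= elen a.1.
Proof. by case: ifP => _ // /andP[? ?]; apply/andP; split; lra. Qed.

Lemma path_ball_end_pt a (r t d : R) : 0 <= r <= elen a.1 -> 0 <= t <= elen a.1 ->
  `|r - t| < d -> path_ball (end_pt a r) d (end_pt a t).
Proof.
move=> hr ht d0; rewrite /end_pt; apply: path_ball_pt; [exact: end_coord..|].
case: ifP => // _; rewrite distrC (_ : _ - _ = r - t)//; ring.
Qed.

Section Lipschitz.
Variables (F : mgraph G -> R) (C : R).
Hypothesis C_ge0 : 0 <= C.
Hypothesis F_lip : forall e r t, 0 <= r <= elen e -> 0 <= t <= elen e ->
  `|F (pt e r) - F (pt e t)| <= C * `|r - t|.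

Lemma path_length_lipschitz x y r : path_length x y r -> `|F x - F y| <= C * r.
Proof.
elim=> [z|e r' t z q hr ht _ IH]; first by rewrite subrr normr0 mulr0.
rewrite -(subrKA (F (pt e t))) (le_trans (ler_normD _ _))// mulrDr.
by rewrite lerD// F_lip.
Qed.

(** The path metric is the largest metric for which each edge is 1-Lipschitz;
    continuity of all the functions below is obtained from this. *)
Lemma edge_lipschitz_continuous : continuous F.
Proof.
move=> x; have xF : ProperFilter (nbhs x) := nbhs_pfilter x.
apply/(@cvgrPdist_lt _ _ _ (F @ x)) => d d0; apply/nbhs_ballP.
have C1 : 0 < C + 1 by rewrite ltr_wpDl.
exists (d / (C + 1)) => /=; first by rewrite divr_gt0.
move=> y [r xyr rd]; apply: le_lt_trans (path_length_lipschitz xyr) _.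
have [r0|r0] := leP r 0; first by rewrite (le_lt_trans _ d0)// mulr_ge0_le0.
rewrite ltr_pdivlMr// in rd; apply: le_lt_trans rd.
by rewrite mulrC ler_pM2l// lerDl.
Qed.

End Lipschitz.

(** On the edge of [a], the distance to the vertex of [a] when that vertex has
    degree one.  Off this edge it is constant, equal to the value at the other
    end of the edge, which keeps it Lipschitz. *)
Definition end_dist a x : R :=
  match x with
  | Vtx v => if v == end_vtx a then 0 else elen a.1
  | @Inner _ _ e r _ =>
      if e == a.1 then (if a.2 then elen e - r else r) else elen a.1
  end.

Definition leaf_end a := forall a', end_vtx a' = end_vtx a -> a' = a.

Section LeafEnd.
Variable a : edge_end.
Hypothesis a_leaf : leaf_end a.

(** The formula for inner points extends to the endpoints of the edge because
    no other end sits at the vertex of [a]. *)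
Lemma end_dist_pt e r : 0 <= r <= elen e -> end_dist a (pt e r) =
  if e == a.1 then (if a.2 then elen e - r else r) else elen a.1.
Proof.
move=> /andP[]; rewrite le_eqVlt => /orP[/eqP <- _|r0].
  rewrite pt_src//=; case: eqP => [ea|ea].
    by have := a_leaf (a' := (e, false)) ea => <- /=; rewrite eqxx.
  case: eqP => // ea1; have : opp_end a = (e, false) \/ a = (e, false).
    by case: a ea1 => ? [] /= ->; [left|right].
  case=> [oa|oa]; last by case: ea; rewrite oa.
  by case: a oa => ? [] //= [->]; rewrite subr0.
rewrite le_eqVlt => /orP[/eqP ->|re]; last first.
  by have h : 0 < r < elen e; [rewrite r0|rewrite (pt_inner h)].
rewrite pt_tgt//=; case: eqP => [ea|ea].
  by have := a_leaf (a' := (e, true)) ea => <- /=; rewrite eqxx subrr.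
case: eqP => // ea1; have : opp_end a = (e, true) \/ a = (e, true).
  by case: a ea1 => ? [] /= ->; [right|left].
case=> [oa|oa]; last by case: ea; rewrite oa.
by case: a oa => ? [] //= [->].
Qed.

Lemma end_dist_end_pt r : 0 <= r <= elen a.1 -> end_dist a (end_pt a r) = r.
Proof.
move=> hr; rewrite /end_pt end_dist_pt ?eqxx; last exact: end_coord.
by case: a.2 => //; ring.
Qed.

Lemma end_dist_bounds x : 0 <= end_dist a x <= elen a.1.
Proof.
have l0 := elen_gt0 a.1.
case: x => [v|e r /andP[h0 h1]] /=; case: ifP => [/eqP ea|_]; rewrite ?lexx ?(ltW l0)//.
by rewrite -ea; apply: end_coord (e, a.2) _ _; rewrite !ltW.
Qed.

Lemma end_dist_continuous : continuous (end_dist a).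
Proof.
apply: (@edge_lipschitz_continuous _ 1) => // e r t hr ht.
rewrite !end_dist_pt// mul1r; case: ifP => _; last by rewrite subrr normr0.
by case: ifP => // _; rewrite [leLHS]distrC (_ : elen e - t - _ = r - t)//; ring.
Qed.

Lemma end_pt_dist x : end_dist a x < elen a.1 -> end_pt a (end_dist a x) = x.
Proof.
case: x => [v|e r h] /=; case: ifP => [/eqP ea|_]; rewrite ?ltxx// => _.
  by rewrite end_pt0 ea.
rewrite /end_pt -ea -(pt_inner h); congr pt.
by case: a.2 => //; ring.
Qed.

End LeafEnd.

End Points.

(** * Distance to a leaf *)

Section Leaves.
Context {R : realType} (G : wgraph R).
Local Notation edge_end := (edge G * bool)%type.
Implicit Types (e : edge G) (a : edge_end) (x : mgraph G) (b v : vertex G).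

(** As in [cut_pt], [pick] has only one choice at a vertex of degree one. *)
Definition leaf_dist b x : R :=
  if [pick a : edge_end | end_vtx a == b] is Some a then end_dist a x else 0.

Definition leaf_len b : R :=
  if [pick a : edge_end | end_vtx a == b] is Some a then elen a.1 else 0.

Section Leaf.
Variable b : vertex G.
Hypothesis b_leaf : degree b = 1%N.

Lemma leaf_end_uniq a a' : end_vtx a = b -> end_vtx a' = b -> a = a'.
Proof.
have /eqP/cards1P [x Ex] := b_leaf; move=> /eqP ab /eqP ab'.
have E z : (end_vtx z == b) = (z == x) by move/setP/(_ z): Ex; rewrite !inE.
by move: ab ab'; rewrite !E => /eqP -> /eqP ->.
Qed.

(** The end picked at a leaf is the same for the cut points, the distance and
    the length. *)
Lemma leafP : exists a, [/\ end_vtx a = b, leaf_end a, cut_pt b = end_pt a,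
  leaf_dist b = end_dist a & leaf_len b = elen a.1].
Proof.
have /eqP/cards1P [x /setP/(_ x)] := b_leaf; rewrite !inE eqxx => /eqP xb.
rewrite /cut_pt /leaf_dist /leaf_len; case: pickP => [a /eqP ab|/(_ x)].
  by exists a; split => // a' a'b; apply: leaf_end_uniq => //; rewrite a'b.
by rewrite xb eqxx.
Qed.

Lemma cut_pt0 : cut_pt b 0 = Vtx b.
Proof. by have [a [ab _ -> _ _]] := leafP; rewrite end_pt0 ab. Qed.

Lemma leaf_len_gt0 : 0 < leaf_len b.
Proof. by have [a [_ _ _ _ ->]] := leafP; exact: elen_gt0. Qed.

Lemma leaf_dist_bounds x : 0 <= leaf_dist b x <= leaf_len b.
Proof. by have [a [_ ? _ -> ->]] := leafP; exact: end_dist_bounds. Qed.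

Lemma leaf_dist_cut r : 0 <= r <= leaf_len b -> leaf_dist b (cut_pt b r) = r.
Proof. by have [a [_ ? -> -> ->]] := leafP; exact: end_dist_end_pt. Qed.

Lemma cut_pt_dist x : leaf_dist b x < leaf_len b -> cut_pt b (leaf_dist b x) = x.
Proof. by have [a [_ ? -> -> ->]] := leafP; exact: end_pt_dist. Qed.

Lemma leaf_dist_continuous : continuous (leaf_dist b).
Proof. by have [a [_ ? _ -> _]] := leafP; exact: end_dist_continuous. Qed.

Lemma path_ball_cut_pt (r t d : R) : 0 <= r <= leaf_len b ->
  0 <= t <= leaf_len b -> `|r - t| < d -> path_ball (cut_pt b r) d (cut_pt b t).
Proof. by have [a [_ ? -> _ ->]] := leafP; exact: path_ball_end_pt. Qed.

Lemma leaf_dist_end_pt a r : end_vtx a = b -> 0 <= r <= elen a.1 ->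
  leaf_dist b (end_pt a r) = r.
Proof.
move=> ab hr; have [a' [a'b ? _ -> _]] := leafP.
have aa' : a = a' by exact: leaf_end_uniq.
by rewrite -aa' end_dist_end_pt// aa'.
Qed.

Lemma leaf_dist_off e r : 0 <= r <= elen e -> esrc e != b -> etgt e != b ->
  leaf_dist b (pt e r) = leaf_len b.
Proof.
move=> hr sb tb; have [a [ab a_leaf _ -> ->]] := leafP.
rewrite end_dist_pt//; case: eqP => // ea; exfalso.
by case: a ab ea {a_leaf} => f [] /= fb fe; move: sb tb;
  rewrite -fb /end_vtx fe /= eqxx.
Qed.

Lemma cut_pt_end a r : end_vtx a = b -> cut_pt b r = end_pt a r.
Proof.
move=> ab; have [a' [a'b _ -> _ _]] := leafP; congr end_pt.
exact: leaf_end_uniq.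
Qed.

Lemma cut_pt_len a : end_vtx a = b ->
  cut_pt b (leaf_len b) = Vtx (end_vtx (opp_end a)).
Proof.
move=> ab; have [a' [a'b _ -> _ ->]] := leafP; have -> : a' = a by exact: leaf_end_uniq.
by rewrite -end_pt0 end_pt_opp subr0.
Qed.

Lemma leaf_opp a : end_vtx a = b -> end_vtx (opp_end a) != b.
Proof.
move=> ab; apply/eqP => ob; have := leaf_end_uniq ab ob.
by case: a {ab ob} => f [].
Qed.

End Leaf.

End Leaves.

(** * The domains cut off at the leaves *)

Record leaf_segments (R : realType) (G : wgraph R) (B : {set vertex G})
    (s : vertex G -> R) : Prop := LeafSegments {
  seg_degree : forall b, b \in B -> degree b = 1%N;
  seg_gt0 : forall b, b \in B -> 0 < s b;
  seg_disjoint : forall b c, b \in B -> c \in B -> b != c ->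
    terminal_seg b (s b) `&` terminal_seg c (s c) = set0;
  seg_vertex : forall b v, b \in B -> v != b ->
    ~ terminal_seg b (s b) (Vtx v) }.

Section Exhaustion.
Context {R : realType} (G : wgraph R) (B : {set vertex G}) (s : vertex G -> R).
Hypothesis seg : leaf_segments B s.
Local Notation edge_end := (edge G * bool)%type.
Implicit Types (e : edge G) (a : edge_end) (x : mgraph G) (b v : vertex G).

Let B_degree := seg_degree seg.
Let s_gt0 := seg_gt0 seg.
Let s_disjoint := seg_disjoint seg.
Let s_vertex := seg_vertex seg.

(** A terminal segment as long as its edge would contain the other end. *)
Lemma seg_lt_len b : b \in B -> s b < leaf_len b.
Proof.
move=> bB; rewrite ltNge; apply/negP => h.
have bl := B_degree bB; have [a [ab _ _ _ _]] := leafP bl.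
apply: (s_vertex bB (leaf_opp bl ab)); exists (leaf_len b) => /=.
  by rewrite h ltW// leaf_len_gt0.
exact: cut_pt_len.
Qed.

Lemma terminal_segE b t : b \in B -> 0 <= t < leaf_len b ->
  terminal_seg b t = [set x | leaf_dist b x <= t].
Proof.
move=> bB /andP[t0 tl]; have bl := B_degree bB; apply/seteqP; split => x /=.
  move=> [r /= /andP[r0 rt] <-]; rewrite leaf_dist_cut// r0.
  exact: le_trans rt (ltW tl).
move=> h; exists (leaf_dist b x) => /=.
  by rewrite h andbT; have /andP[] := leaf_dist_bounds bl x.
by rewrite cut_pt_dist// (le_lt_trans h).
Qed.

Lemma terminal_seg_s b : b \in B ->
  terminal_seg b (s b) = [set x | leaf_dist b x <= s b].
Proof. by move=> bB; rewrite terminal_segE// ltW ?s_gt0//= seg_lt_len. Qed.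

Lemma leaf_dist_cut_other b c r : b \in B -> c \in B -> b != c ->
  0 <= r <= s b -> s c < leaf_dist c (cut_pt b r).
Proof.
move=> bB cB bc /andP[r0 rs]; rewrite ltNge; apply/negP => h.
have : (terminal_seg b (s b) `&` terminal_seg c (s c)) (cut_pt b r).
  rewrite !terminal_seg_s//; split => //=; rewrite leaf_dist_cut//; first exact: B_degree.
  by rewrite r0 (le_trans rs)// ltW// seg_lt_len.
by rewrite s_disjoint.
Qed.

(** The cut lengths for which the removed segments stay inside the disjoint
    terminal segments; [0] is one of them and gives the domain itself. *)
Definition admissible (t : R) := 0 <= t /\ forall b, b \in B -> t < s b.

Lemma admissible0 : admissible 0.
Proof. by split. Qed.

Lemma domain_exhaustion : domain B = exhaustion B 0.
Proof.
rewrite /domain /exhaustion /ideal_pts; congr (~` _).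
apply/seteqP; split => x /=.
  move=> [b /= bB <-]; exists b => //=; exists 0 => //=; first by rewrite lexx.
  by rewrite cut_pt0// B_degree.
move=> [b /= bB [r /= r0 <-]]; exists b => //.
by rewrite -(le_anti r0) cut_pt0// B_degree.
Qed.

(** The parameters at which the edge enters and leaves the cut-off domain. *)
Definition inner_ends e (t : R) : R * R :=
  (if esrc e \in B then t else 0, if etgt e \in B then elen e - t else elen e).

Arguments inner_ends : simpl never.

Section Admissible.
Variable t : R.
Hypothesis t_adm : admissible t.

Let t_ge0 : 0 <= t. Proof. by case: t_adm. Qed.
Let t_lt_s b : b \in B -> t < s b. Proof. by case: t_adm => _; apply. Qed.

Lemma cut_lt_len b : b \in B -> t < leaf_len b.
Proof. by move=> bB; apply: lt_trans (seg_lt_len bB); exact: t_lt_s. Qed.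

Lemma exhaustionE : exhaustion B t = [set x | forall b, b \in B -> t < leaf_dist b x].
Proof.
apply/seteqP; split => x /=.
  move=> h b bB; rewrite ltNge; apply/negP => tx; apply: h; exists b => //.
  by rewrite terminal_segE ?t_ge0 ?cut_lt_len.
move=> h [b /= bB]; rewrite terminal_segE ?t_ge0 ?cut_lt_len//= leNgt.
by rewrite h.
Qed.

Lemma exhaustion_cut b r : b \in B -> t < r <= s b -> exhaustion B t (cut_pt b r).
Proof.
move=> bB /andP[tr rs]; rewrite exhaustionE => c cB /=.
have [<-|bc] := eqVneq b c.
  rewrite leaf_dist_cut ?B_degree// (le_trans t_ge0 (ltW tr))/=.
  by rewrite (le_trans rs)// ltW// seg_lt_len.
apply: lt_trans (leaf_dist_cut_other bB cB bc _); first exact: t_lt_s.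
by rewrite (le_trans t_ge0 (ltW tr)).
Qed.

Lemma open_exhaustion : open (exhaustion B t).
Proof.
have -> : exhaustion B t = ~` \bigcup_(b in [set` B]) [set x | leaf_dist b x <= t].
  rewrite exhaustionE; apply/seteqP; split => x /=.
    by move=> h [b bB /=]; rewrite leNgt h.
  move=> h b bB; rewrite ltNge; apply/negP => xt; apply: h; by exists b.
rewrite openC; apply: closed_bigcup => // b bB.
apply: (@closed_comp _ _ (leaf_dist b) [set y | y <= t]); last exact: closed_le.
by move=> x _; apply: leaf_dist_continuous; exact: B_degree.
Qed.

(** A cut point is the limit of the points of its edge that lie slightly
    farther from the leaf. *)
Lemma closure_exhaustion :
  closure (exhaustion B t) = [set x | forall b, b \in B -> t <= leaf_dist b x].
Proof.
apply/seteqP; split => x /=.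
  move=> xU b bB.
  have : closed [set y | t <= leaf_dist b y].
    apply: (@closed_comp _ _ (leaf_dist b) [set y | t <= y]); last exact: closed_ge.
    by move=> y _; apply: leaf_dist_continuous; exact: B_degree.
  apply; apply: closure_subset xU => y; rewrite exhaustionE => /(_ b bB) /=.
  exact: ltW.
move=> h; have [xU|xU] := pselect (exhaustion B t x); first exact: subset_closure.
move: xU; rewrite exhaustionE => /existsNP[b /not_implyP[bB /negP]].
rewrite -leNgt => bt; have bd : leaf_dist b x = t by apply/le_anti; rewrite bt h.
have <- : cut_pt b t = x by rewrite -bd cut_pt_dist ?B_degree// bd cut_lt_len.
move=> A /nbhs_ballP[d /= d0 dA].
pose m := Num.min (s b) (t + d / 2).
have tm : t < m by rewrite lt_min t_lt_s//=; lra.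
have ms : m <= s b by rewrite ge_min lexx.
have md : m <= t + d / 2 by rewrite ge_min lexx orbT.
exists (cut_pt b m); split; first by rewrite -exhaustionE; apply: exhaustion_cut; rewrite ?tm.
apply: dA; apply: path_ball_cut_pt; rewrite ?t_ge0/= ?B_degree//.
- by rewrite ltW// cut_lt_len.
- by rewrite (le_trans t_ge0 (ltW tm))/= (le_trans ms)// ltW// seg_lt_len.
- by rewrite ltr0_norm; lra.
Qed.

Lemma boundary_exhaustion :
  boundary (exhaustion B t) = [set cut_pt b t | b in [set` B]].
Proof.
rewrite /boundary; have /interior_id -> := open_exhaustion.
rewrite closure_exhaustion exhaustionE.
apply/seteqP; split => x /=.
  move=> [h /existsNP[b /not_implyP[bB /negP]]].
  rewrite -leNgt => bt; have bd : leaf_dist b x = t by apply/le_anti; rewrite bt h.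
  by exists b => //; rewrite -bd cut_pt_dist ?B_degree// bd cut_lt_len.
move=> [b /= bB <-]; have bt : leaf_dist b (cut_pt b t) = t.
  by rewrite leaf_dist_cut ?B_degree// t_ge0 ltW// cut_lt_len.
split; last by move=> /(_ b bB); rewrite bt ltxx.
move=> c cB; have [<-|bc] := eqVneq b c; first by rewrite bt.
rewrite ltW//; apply: lt_trans (leaf_dist_cut_other bB cB bc _); first exact: t_lt_s.
by rewrite t_ge0 ltW// t_lt_s.
Qed.

Lemma cut_pt_inj : {in B &, injective (fun b => cut_pt b t)}.
Proof.
move=> b c bB cB /(congr1 (leaf_dist c)) /=.
rewrite [RHS]leaf_dist_cut ?B_degree ?t_ge0//= ?ltW ?cut_lt_len// => bct.
apply/eqP; apply: contraT => bc.
have : s c < t by rewrite -bct; apply: leaf_dist_cut_other; rewrite ?t_ge0 ?ltW ?t_lt_s.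
by rewrite ltNge ltW// t_lt_s.
Qed.

Lemma leaf_dist_src e r : esrc e \in B -> 0 <= r <= elen e ->
  leaf_dist (esrc e) (pt e r) = r.
Proof. by move=> eB hr; apply: (leaf_dist_end_pt (B_degree eB) (a := (e, false))). Qed.

Lemma leaf_dist_tgt e r : etgt e \in B -> 0 <= r <= elen e ->
  leaf_dist (etgt e) (pt e r) = elen e - r.
Proof.
move=> eB hr; have {1}-> : r = elen e - (elen e - r) by ring.
apply: (leaf_dist_end_pt (B_degree eB) (a := (e, true))) => //=.
exact: (end_coord (a := (e, true))).
Qed.

Lemma leaf_len_src e : esrc e \in B -> leaf_len (esrc e) = elen e.
Proof.
move=> eB; have [a [ab _ _ _ ->]] := leafP (B_degree eB).
by rewrite (leaf_end_uniq (B_degree eB) (a' := (e, false)) ab).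
Qed.

Lemma leaf_len_tgt e : etgt e \in B -> leaf_len (etgt e) = elen e.
Proof.
move=> eB; have [a [ab _ _ _ ->]] := leafP (B_degree eB).
by rewrite (leaf_end_uniq (B_degree eB) (a' := (e, true)) ab).
Qed.

(** The case that needs the disjointness of the terminal segments is an edge
    joining two leaves: otherwise its midpoint would lie in both. *)
Lemma inner_ends_lt e : (inner_ends e t).1 < (inner_ends e t).2.
Proof.
have l0 := elen_gt0 e; rewrite /inner_ends.
case: ifP => sB; case: ifP => tB //=.
- have st : esrc e != etgt e by exact: (leaf_opp (B_degree tB) (a := (e, true))).
  rewrite ltNge; apply/negP => h.
  have hr : 0 <= elen e / 2 <= elen e by apply/andP; split; lra.
  have : (terminal_seg (esrc e) (s (esrc e)) `&`
          terminal_seg (etgt e) (s (etgt e))) (pt e (elen e / 2)).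
    rewrite !terminal_seg_s//; split => /=.
      by rewrite leaf_dist_src//; have := t_lt_s sB; lra.
    by rewrite leaf_dist_tgt//; have := t_lt_s tB; lra.
  by rewrite s_disjoint.
- by rewrite -leaf_len_src// cut_lt_len.
- by have := cut_lt_len tB; rewrite leaf_len_tgt//; lra.
Qed.

Lemma inner_ends_bounds e : 0 <= (inner_ends e t).1 /\ (inner_ends e t).2 <= elen e.
Proof. by rewrite /inner_ends /=; have := t_ge0; split; case: ifP => _ //; lra. Qed.

Lemma closure_exhaustion_pt e r : 0 <= r <= elen e ->
  closure (exhaustion B t) (pt e r) <->
    (inner_ends e t).1 <= r <= (inner_ends e t).2.
Proof.
move=> hr; rewrite closure_exhaustion /inner_ends /=; split => [h|].
  apply/andP; split; case: ifP => eB; try by case/andP: hr.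
    by rewrite -[leRHS](@leaf_dist_src e)//; exact: h.
  by have := h _ eB; rewrite leaf_dist_tgt//; lra.
move=> /andP[h1 h2] b bB.
have [sb|sb] := eqVneq (esrc e) b.
  by move: h1; rewrite sb bB -sb leaf_dist_src// sb.
have [tb|tb] := eqVneq (etgt e) b.
  by move: h2; rewrite tb bB -tb leaf_dist_tgt ?tb//; lra.
by rewrite leaf_dist_off ?B_degree// ltW// cut_lt_len.
Qed.

Lemma exhaustion_pt e r : 0 <= r <= elen e ->
  (inner_ends e t).1 < r < (inner_ends e t).2 -> exhaustion B t (pt e r).
Proof.
move=> hr; rewrite exhaustionE /inner_ends /= => /andP[h1 h2] b bB.
have [sb|sb] := eqVneq (esrc e) b.
  by move: h1; rewrite sb bB -sb leaf_dist_src// sb.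
have [tb|tb] := eqVneq (etgt e) b.
  by move: h2; rewrite tb bB -tb leaf_dist_tgt ?tb//; lra.
by rewrite leaf_dist_off ?B_degree// cut_lt_len.
Qed.

Lemma exhaustion_ptP e r : 0 < r < elen e -> exhaustion B t (pt e r) ->
  (inner_ends e t).1 < r < (inner_ends e t).2.
Proof.
move=> /andP[r0 r1]; rewrite exhaustionE /inner_ends /= => h.
have hr : 0 <= r <= elen e by rewrite !ltW.
apply/andP; split; case: ifP => // eB; have := h _ eB.
  by rewrite leaf_dist_src.
by rewrite leaf_dist_tgt//; lra.
Qed.

Lemma exhaustion_vtx v : exhaustion B t (Vtx v) <-> v \notin B.
Proof.
rewrite exhaustionE /=; split => [h|vB b bB].
  apply/negP => vB; have := h _ vB.
  have vl := B_degree vB.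
  by rewrite -cut_pt0// leaf_dist_cut// ?lexx ?ltW ?leaf_len_gt0// ltNge t_ge0.
apply: lt_le_trans (cut_lt_len bB) _.
have [a [ab _ _ -> ->]] := leafP (B_degree bB).
by rewrite /= ab; case: eqP => // vb; rewrite vb bB in vB.
Qed.

End Admissible.

Lemma exhaustion_le t t' : admissible t -> admissible t' -> t <= t' ->
  closure (exhaustion B t') `<=` closure (exhaustion B t).
Proof.
move=> ta ta' tt' x; rewrite !closure_exhaustion// => h b bB.
exact: le_trans tt' (h b bB).
Qed.

Lemma exhaustion_lt t t' : admissible t -> admissible t' -> t < t' ->
  closure (exhaustion B t') `<=` exhaustion B t.
Proof.
move=> ta ta' tt' x; rewrite closure_exhaustion// exhaustionE// => h b bB.
exact: lt_le_trans tt' (h b bB).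
Qed.

End Exhaustion.
Arguments inner_ends : simpl never.

(** * Affine functions on an edge *)

Section Affine.
Context {R : realType}.
Implicit Types (g : R -> R) (lo hi p q r : R).

(** Every compact subinterval can be enlarged to contain two fixed points, and
    these already determine the affine function. *)
Lemma affine_open_itv g lo hi : lo < hi ->
  (forall r1 r2, lo < r1 -> r1 <= r2 -> r2 < hi ->
    exists p q, forall r, r1 <= r <= r2 -> g r = p * r + q) ->
  exists p q, forall r, lo < r < hi -> g r = p * r + q.
Proof.
(* The points at one third and two thirds of the interval fix the coefficients. *)
move=> lohi aff; pose m1 := lo + (hi - lo) / 3; pose m2 := m1 + (hi - lo) / 3.
have lm1 : lo < m1 by rewrite /m1; lra.
have m12 : m1 < m2 by rewrite /m2; lra.
have m2h : m2 < hi by rewrite /m2 /m1; lra.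
have [p [q pq]] := aff _ _ lm1 (ltW m12) m2h; exists p, q => r /andP[lr rh].
have [|||p' [q' pq']] := aff (Num.min r m1) (Num.max r m2).
- by rewrite lt_min lr.
- by rewrite ge_min le_max lexx.
- by rewrite gt_max rh.
have e1 : p' * m1 + q' = p * m1 + q.
  by rewrite -pq -?pq' ?lexx ?(ltW m12)// ge_min le_max lexx (ltW m12) ?orbT.
have e2 : p' * m2 + q' = p * m2 + q.
  by rewrite -pq -?pq' ?lexx ?(ltW m12)// ge_min le_max lexx (ltW m12) ?orbT.
have pp : p' = p.
  apply/eqP; rewrite -subr_eq0; have : (p' - p) * (m2 - m1) == 0 by apply/eqP; lra.
  by rewrite mulf_eq0 [X in _ || X]subr_eq0 (gt_eqF m12) orbF.
have qq : q' = q by rewrite pp in e1; lra.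
by rewrite pq' ?pp ?qq// ge_min le_max lexx.
Qed.

Lemma affine_cvg (F : set_system R) {FF : ProperFilter F} p q r0 :
  F --> r0 -> p * r + q @[r --> F] --> p * r0 + q.
Proof. by move=> Fr; apply: cvgD; [apply: cvgMl_tmp|exact: cvg_cst]. Qed.

Lemma affine_closed_itv g lo hi p q : lo < hi ->
  g r @[r --> lo^'+] --> g lo -> g r @[r --> hi^'-] --> g hi ->
  (forall r, lo < r < hi -> g r = p * r + q) ->
  forall r, lo <= r <= hi -> g r = p * r + q.
Proof.
move=> lohi glo ghi pq r /andP[]; rewrite le_eqVlt => /orP[/eqP <- _|lr].
  have H : g r @[r --> lo^'+] --> p * lo + q.
    have A : p * x + q @[x --> lo^'+] --> p * lo + q.
    by apply: affine_cvg; apply: cvg_at_right_filter; exact: cvg_id.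
  apply: cvg_trans A.
    apply: near_eq_cvg; near=> x; rewrite pq//; apply/andP; split; near: x.
      exact: nbhs_right_gt.
    exact: nbhs_right_lt.
  exact: cvg_unique glo H.
rewrite le_eqVlt => /orP[/eqP ->|rh]; last by rewrite pq// lr.
have H : g r @[r --> hi^'-] --> p * hi + q.
  have A : p * x + q @[x --> hi^'-] --> p * hi + q.
    by apply: affine_cvg; apply: cvg_at_left_filter; exact: cvg_id.
  apply: cvg_trans A.
  apply: near_eq_cvg; near=> x; rewrite pq//; apply/andP; split; near: x.
    exact: nbhs_left_gt.
  exact: nbhs_left_lt.
exact: cvg_unique ghi H.
Unshelve. all: by end_near. Qed.

End Affine.

Section WithinEdge.
Context {R : realType} (G : wgraph R).

Lemma within_edge_cvg (C : set (mgraph G)) (w : mgraph G -> R) e r0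
    (F : set_system R) {FF : Filter F} :
  {within C, continuous w} -> 0 <= r0 <= elen e -> C (pt e r0) -> F --> r0 ->
  (\forall r \near F, 0 <= r <= elen e /\ C (pt e r)) ->
  w (pt e r) @[r --> F] --> w (pt e r0).
Proof.
move=> /subspace_continuousP wC hr0 Cr0 Fr0 FC A wA.
have /nbhs_ballP[d /= d0 dA] : nbhs (pt e r0) [set x | C x -> A (w x)].
  exact: (wC _ Cr0 A wA).
suff H : \forall r \near F, A (w (pt e r)) by exact: H.
near=> r; have [hr Cr] : 0 <= r <= elen e /\ C (pt e r) by near: r.
apply: dA => //; apply: path_ball_pt => //.
Unshelve. all: by end_near. Qed.

Lemma end_deriv_affine (w : mgraph G -> R) a k (l : R) : 0 < l ->
  (forall r, 0 <= r <= l -> w (end_pt a r) = w (end_pt a 0) + k * r) ->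
  end_deriv w a = k.
Proof.
move=> l0 wE; apply: cvg_lim => //.
have kk : (fun=> k) @ (0 : R)^'+ --> k by exact: cvg_cst.
apply: cvg_trans kk; apply: near_eq_cvg; near=> r.
have r0 : 0 < r by near: r; exact: nbhs_right_gt.
have rl : r <= l by near: r; exact: nbhs_right_le.
have -> : w (end_pt a r) - w (end_pt a 0) = k * r.
  by rewrite wE ?(ltW r0)//; ring.
by rewrite mulrCA mulVf ?gt_eqF ?mulr1.
Unshelve. all: by end_near. Qed.

End WithinEdge.

Lemma clamp_lipschitz (R : realType) (l h r r' : R) : l < h ->
  `|Num.max l (Num.min r h) - Num.max l (Num.min r' h)| <= `|r - r'|.
Proof.
move=> lh; have [rr|rr] := leP r r'; [rewrite (ler0_norm (_ : r - r' <= 0))|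
  rewrite (gtr0_norm (_ : 0 < r - r'))]; rewrite ?subr_le0 ?subr_gt0//;
  rewrite ler_norml; have [h1|h1] := leP r h; have [h2|h2] := leP r' h;
  (have [?|?] := leP l r); (have [?|?] := leP l r');
  (have [?|?] := leP l h); apply/andP; split; lra.
Qed.

(** * The Dirichlet problem on a cut-off domain *)

Section Dirichlet.
Context {R : realType} (G : wgraph R) (B : {set vertex G}).
Hypothesis B_neq0 : B != finset.set0.
Local Notation edge_end := (edge G * bool)%type.
Implicit Types (e : edge G) (a : edge_end) (x : mgraph G) (b v : vertex G).
Implicit Types (w : mgraph G -> R) (phi : vertex G -> R).

Variable s : vertex G -> R.
Hypothesis seg : leaf_segments B s.
Let B_degree := seg_degree seg.

Variable t : R.
Hypothesis t_adm : admissible B s t.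

Local Notation U := (exhaustion B t).
Local Notation C := (closure (exhaustion B t)).
Local Notation lo e := (inner_ends B e t).1.
Local Notation hi e := (inner_ends B e t).2.

Let t_ge0 : 0 <= t. Proof. by case: t_adm. Qed.
Let lo_lt_hi e : lo e < hi e.
Proof. exact: (inner_ends_lt seg t_adm). Qed.
Let lo_ge0 e : 0 <= lo e. Proof. by case: (inner_ends_bounds t_adm e). Qed.
Let hi_le e : hi e <= elen e. Proof. by case: (inner_ends_bounds t_adm e). Qed.

(** Cutting at the leaves only shortens the terminal edges; the weight of an
    edge of the cut-off graph is the inverse of the length that remains. *)
Definition conductance e : R := (hi e - lo e)^-1.

Lemma conductance_gt0 e : 0 < conductance e.
Proof. by rewrite invr_gt0 subr_gt0. Qed.

(** The vertices of the cut-off graph: a leaf is replaced by its cut point. *)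
Definition node v : mgraph G := if v \in B then cut_pt v t else Vtx v.

Lemma node_src e : node (esrc e) = pt e (lo e).
Proof.
rewrite /node /=; case: ifP => eB; last by rewrite pt_src.
exact: (cut_pt_end (B_degree eB) (a := (e, false)) t erefl).
Qed.

Lemma node_tgt e : node (etgt e) = pt e (hi e).
Proof.
rewrite /node /=; case: ifP => eB; last by rewrite pt_tgt.
exact: (cut_pt_end (B_degree eB) (a := (e, true)) t erefl).
Qed.

(** The affine extension of values at the nodes.  It is made constant beyond
    the cut points so as to be continuous on the whole graph, including at the
    removed leaves. *)
Definition interp phi x : R :=
  match x with
  | Vtx v => phi v
  | @Inner _ _ e r _ => phi (esrc e) + (phi (etgt e) - phi (esrc e)) *
      (conductance e * (Num.max (lo e) (Num.min r (hi e)) - lo e))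
  end.

Lemma interp_pt_clamp phi e r : 0 <= r <= elen e -> interp phi (pt e r) =
  phi (esrc e) + (phi (etgt e) - phi (esrc e)) *
      (conductance e * (Num.max (lo e) (Num.min r (hi e)) - lo e)).
Proof.
move=> /andP[]; rewrite le_eqVlt => /orP[/eqP <- _|r0].
  rewrite pt_src//= min_l; last by rewrite ltW// (le_lt_trans (lo_ge0 e)).
  by rewrite max_l ?lo_ge0// subrr !mulr0 addr0.
rewrite le_eqVlt => /orP[/eqP ->|re]; last first.
  by have h : 0 < r < elen e; [rewrite r0|rewrite (pt_inner h)].
rewrite pt_tgt//= min_r ?hi_le// max_r ?(ltW (lo_lt_hi e))// mulVf ?mulr1 ?subrKC//.
by rewrite gt_eqF// subr_gt0.
Qed.

Lemma interp_pt phi e r : lo e <= r <= hi e -> interp phi (pt e r) =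
  phi (esrc e) + (phi (etgt e) - phi (esrc e)) * (conductance e * (r - lo e)).
Proof.
move=> /andP[h1 h2]; rewrite interp_pt_clamp.
  by rewrite min_l// max_r.
by rewrite (le_trans (lo_ge0 e) h1) (le_trans h2) ?hi_le.
Qed.

Lemma interp_node phi v : interp phi (node v) = phi v.
Proof.
have [vB|vB] := boolP (v \in B); last by rewrite /node (negbTE vB).
have [[e []] [<- _ _ _ _]] := leafP (B_degree vB); rewrite /end_vtx /=.
  rewrite node_tgt interp_pt ?lexx ?(ltW (lo_lt_hi e))//= mulVf ?mulr1 ?subrKC//.
  by rewrite gt_eqF// subr_gt0.
by rewrite node_src interp_pt ?lexx ?(ltW (lo_lt_hi e))//= subrr !mulr0 addr0.
Qed.

Lemma interp_continuous phi : continuous (interp phi).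
Proof.
pose M := \sum_e `|(phi (etgt e) - phi (esrc e)) * conductance e|.
apply: (@edge_lipschitz_continuous _ _ _ M) => [|e r r' hr hr'].
  by apply: sumr_ge0.
rewrite !interp_pt_clamp//.
set k := conductance e; set d := phi _ - phi _.
have -> : forall x y : R, phi (esrc e) + d * (k * (x - lo e)) -
    (phi (esrc e) + d * (k * (y - lo e))) = (d * k) * (x - y) by move=> x y; ring.
rewrite normrM ler_pM//.
  by rewrite /M (bigD1 e)//= lerDl sumr_ge0.
have lh := lo_lt_hi e.
exact: clamp_lipschitz.
Qed.

Definition solution phi : mgraph G -> R := interp phi \_ C.

Lemma solutionE phi x : C x -> solution phi x = interp phi x.
Proof. by move=> Cx; rewrite /solution patchE mem_set. Qed.

Lemma nodes_closure v : C (node v).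
Proof.
rewrite /node; case: ifPn => vB; last first.
  by apply: subset_closure; apply/(exhaustion_vtx seg t_adm).
suff : boundary U (cut_pt v t) by case.
by rewrite (boundary_exhaustion seg t_adm)//; exists v.
Qed.

Lemma solution_node phi v : solution phi (node v) = phi v.
Proof. by rewrite solutionE ?interp_node//; exact: nodes_closure. Qed.

(** For an affine function the derivative along an end is the difference
    quotient over the part of the edge inside the domain, so Kirchhoff's
    condition is the vanishing of the flow. *)
Lemma end_deriv_interp w phi v a : (forall x, C x -> w x = interp phi x) ->
  v \notin B -> end_vtx a = v ->
  end_deriv w a = conductance a.1 * (phi (end_vtx (opp_end a)) - phi v).
Proof.
move=> wE + av; rewrite -{}av; case: a => e [] /=; rewrite /end_vtx /= => vB.
  have he : hi e = elen e by rewrite /inner_ends /= (negbTE vB).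
  apply: (@end_deriv_affine _ _ _ _ _ (hi e - lo e)); first by rewrite subr_gt0.
  move=> r /andP[r0 rl]; rewrite /end_pt /= subr0.
  have l0 := lo_ge0 e; have lh := lo_lt_hi e.
  have Hr : lo e <= elen e - r <= hi e by apply/andP; split; lra.
  have He : lo e <= elen e <= hi e by apply/andP; split; lra.
  rewrite !wE ?interp_pt//; try by apply/(closure_exhaustion_pt seg t_adm) => //;
    apply/andP; split; lra.
  by ring.
have le : lo e = 0 by rewrite /inner_ends /= (negbTE vB).
apply: (@end_deriv_affine _ _ _ _ _ (hi e - lo e)); first by rewrite subr_gt0.
move=> r /andP[r0 rl]; rewrite /end_pt /=.
have h0 := hi_le e; have lh := lo_lt_hi e; have e0 := elen_gt0 e.
have Hr : lo e <= r <= hi e by apply/andP; split; lra.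
have He : lo e <= 0 <= hi e by apply/andP; split; lra.
rewrite !wE ?interp_pt//; try by apply/(closure_exhaustion_pt seg t_adm) => //;
  apply/andP; split; lra.
by rewrite le; ring.
Qed.

Lemma kirchhoff_flow w phi v : (forall x, C x -> w x = interp phi x) ->
  v \notin B ->
  \sum_(a : edge_end | end_vtx a == v) end_deriv w a = flow conductance phi v.
Proof.
by move=> wE vB; apply: eq_bigr => a /eqP av; rewrite (end_deriv_interp wE vB).
Qed.

Lemma closure_pt_ex x : C x -> (exists2 v, x = Vtx v & x = node v) \/
  exists e r, lo e <= r <= hi e /\ x = pt e r.
Proof.
move: x; apply: mgraph_case => [v Cv|e r /andP[r0 r1] Cr]; [left|right].
  exists v => //; rewrite /node; case: ifPn => // vB.
  move: Cv; rewrite (closure_exhaustion seg t_adm)// => /(_ _ vB).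
  have [a [av _ _ -> _]] := leafP (B_degree vB).
  rewrite /= av eqxx => t0; have -> : t = 0 by apply/le_anti; rewrite t0 t_ge0.
  by rewrite cut_pt0// B_degree.
by exists e, r; split => //; apply/(closure_exhaustion_pt seg t_adm); rewrite ?ltW.
Qed.

Lemma edge_affine_open w e : edge_affine U w ->
  exists p q, forall r, lo e < r < hi e -> w (pt e r) = p * r + q.
Proof.
move=> wU; apply: (affine_open_itv (g := fun r => w (pt e r))).
  exact: lo_lt_hi.
move=> r1 r2 h1 h12 h2; apply: wU => //.
- by rewrite (le_trans (lo_ge0 e))// ltW.
- by rewrite (le_trans (ltW h2))// hi_le.
- move=> r /andP[rr1 rr2].
  have l1 : lo e < r by exact: lt_le_trans h1 rr1.
  have l2 : r < hi e by exact: le_lt_trans rr2 h2.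
  apply: (exhaustion_pt seg t_adm); rewrite ?l1//.
  by rewrite (le_trans (lo_ge0 e) (ltW l1)) (le_trans (ltW l2))// hi_le.
Qed.

(** The edges are first handled in their interior, where the domain is open,
    and then closed up by continuity, since the cut points lie outside the
    domain. *)
Lemma harmonic_interp w : {within C, continuous w} -> edge_affine U w ->
  forall x, C x -> w x = interp (w \o node) x.
Proof.
move=> wC wU.
have ptC e r : lo e <= r <= hi e -> 0 <= r <= elen e /\ C (pt e r).
  move=> /andP[h1 h2]; have hr : 0 <= r <= elen e.
    by rewrite (le_trans (lo_ge0 e))//= (le_trans h2)// hi_le.
  by split => //; apply/(closure_exhaustion_pt seg t_adm) => //; rewrite h1.
have edge_E e : exists p q, forall r, lo e <= r <= hi e -> w (pt e r) = p * r + q.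
  have [p [q pq]] := edge_affine_open e wU.
  exists p, q; apply: affine_closed_itv (lo_lt_hi e) _ _ pq.
  - apply: (within_edge_cvg wC); [| |exact: cvg_at_right_filter cvg_id|].
    + by have [] := ptC e (lo e); rewrite ?lexx ?(ltW (lo_lt_hi e)).
    + by have [] := ptC e (lo e); rewrite ?lexx ?(ltW (lo_lt_hi e)).
    + near=> r; apply: ptC; apply/andP; split.
        by near: r; exact: nbhs_right_ge.
      by near: r; apply: nbhs_right_le; exact: lo_lt_hi.
  - apply: (within_edge_cvg wC); [| |exact: cvg_at_left_filter cvg_id|].
    + by have [] := ptC e (hi e); rewrite ?lexx ?(ltW (lo_lt_hi e)).
    + by have [] := ptC e (hi e); rewrite ?lexx ?(ltW (lo_lt_hi e)).
    + near=> r; apply: ptC; apply/andP; split.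
        by near: r; apply: nbhs_left_ge; exact: lo_lt_hi.
      by near: r; exact: nbhs_left_le.
move=> x /closure_pt_ex[[v xv xn]|[e [r [hr ->]]]]; first by rewrite xv/= -xn xv.
have [p [q pq]] := edge_E e.
have c1 : conductance e * (hi e - lo e) = 1.
  by rewrite mulVf// gt_eqF// subr_gt0 lo_lt_hi.
rewrite interp_pt//= node_src node_tgt !pq ?lexx ?(ltW (lo_lt_hi e))//.
rewrite (_ : p * hi e + q - (p * lo e + q) = p * (hi e - lo e)); last by ring.
have -> : p * (hi e - lo e) * (conductance e * (r - lo e)) =
  (conductance e * (hi e - lo e)) * p * (r - lo e) by ring.
by rewrite c1; ring.
Unshelve. all: by end_near. Qed.

Lemma harmonic_discrete w : {within C, continuous w} -> harmonic_on U w ->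
  discrete_harmonic B conductance (w \o node).
Proof.
move=> wC [_ wU wK] v vB; rewrite -(kirchhoff_flow (harmonic_interp wC wU))//.
by apply: wK; apply/(exhaustion_vtx seg t_adm).
Qed.

(** The discrete problem solves the continuous one; with [harmonic_discrete]
    the two are equivalent. *)
Lemma solution_dirichlet phi f : discrete_harmonic B conductance phi ->
  (forall b, b \in B -> phi b = f (cut_pt b t)) ->
  dirichlet_solution U f (solution phi).
Proof.
move=> phiH phif.
have sC : {within C, continuous (solution phi)}.
  apply: (@subspace_eq_continuous _ C _ (interp phi) (solution phi)).
    by move=> x; rewrite inE => Cx; symmetry; apply: solutionE.
  by apply: continuous_subspaceT; exact: interp_continuous.
split => //.
- split.
  + by apply: continuous_subspaceW sC; exact: subset_closure.
  + move=> e r1 r2 h1 h12 h2 Ur.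
    have Cr r : r1 <= r <= r2 -> lo e <= r <= hi e.
      move=> hr; apply/(closure_exhaustion_pt seg t_adm) => //.
        by case/andP: hr => a1 a2; rewrite (le_trans h1 a1) (le_trans a2).
      by apply: subset_closure; exact: Ur.
    exists ((phi (etgt e) - phi (esrc e)) * conductance e),
      (phi (esrc e) - (phi (etgt e) - phi (esrc e)) * conductance e * lo e).
    move=> r hr; rewrite solutionE ?interp_pt ?Cr//; first by ring.
    by apply: subset_closure; exact: Ur.
  + move=> v /(exhaustion_vtx seg t_adm) vB.
    by rewrite (kirchhoff_flow (@solutionE phi))// phiH//; apply.
- rewrite (boundary_exhaustion seg t_adm)// => y [b /= bB <-].
  by have := solution_node phi b; rewrite /node bB => ->; rewrite phif.
- by move=> y Cy; rewrite /solution patchE memNset.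
Qed.

Lemma dirichlet_solvable f : exists h, dirichlet_solution U f h.
Proof.
have [phi phiH phif] := discrete_dirichlet conductance_gt0 B_neq0
  (fun b => f (cut_pt b t)).
by exists (solution phi); exact: solution_dirichlet.
Qed.

End Dirichlet.

Lemma harmonic_onW (R : realType) (G : wgraph R) (U V : set (mgraph G)) w :
  U `<=` V -> harmonic_on V w -> harmonic_on U w.
Proof.
move=> UV [wc wa wk]; split.
- exact: continuous_subspaceW wc.
- move=> e s t s0 st te Ur; apply: wa => // r hr; exact/UV/Ur.
- by move=> v Uv; apply: wk; exact: UV.
Qed.

(** * Poisson formula and dependence on the cut *)

Section Poles.
Context {R : realType} (G : wgraph R) (B : {set vertex G}).
Hypothesis B_neq0 : B != finset.set0.
Local Notation edge_end := (edge G * bool)%type.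
Implicit Types (e : edge G) (a : edge_end) (x : mgraph G) (b v : vertex G).
Implicit Types (w : mgraph G -> R) (phi : vertex G -> R).
Variable s : vertex G -> R.
Hypothesis seg : leaf_segments B s.
Let B_degree := seg_degree seg.

(** The harmonic measure of the cut point of [b], $H_{b_t}^{D_t}$; for [t = 0]
    it is $H_b^D$. *)
Definition pole (t : R) b : mgraph G -> R :=
  harm (exhaustion B t) (cut_pt b t).

Section FixedCut.
Variable t : R.
Hypothesis t_adm : admissible B s t.
Local Notation U := (exhaustion B t).
Local Notation C := (closure (exhaustion B t)).
Local Notation node := (node B t).
Local Notation cond := (conductance B t).

Lemma pole_dirichlet b : dirichlet_solution U (\1_[set cut_pt b t]) (pole t b).
Proof.
have := dirichlet_solvable B_neq0 seg t_adm (\1_[set cut_pt b t]).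
rewrite /pole /harm /harmonic_extension => -[h hH].
exact: (xgetPex (cst 0) (ex_intro _ h hH)).
Qed.

Lemma pole_continuous b : {within C, continuous (pole t b)}.
Proof. by case: (pole_dirichlet b). Qed.

Lemma pole_harmonic b : harmonic_on U (pole t b).
Proof. by case: (pole_dirichlet b). Qed.

Lemma cut_boundary b : b \in B -> boundary U (cut_pt b t).
Proof. by move=> bB; rewrite (boundary_exhaustion seg t_adm); exists b. Qed.

Lemma cut_closure b : b \in B -> C (cut_pt b t).
Proof. by case/cut_boundary. Qed.

Lemma pole_cut b c : b \in B -> c \in B -> pole t b (cut_pt c t) = (c == b)%:R.
Proof.
move=> bB cB; have cb := cut_boundary cB.
have [_ _ /(_ _ cb) -> _] := pole_dirichlet b.
rewrite indicE; congr (_%:R); apply: congr1; apply/idP/eqP => [|->].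
  by rewrite inE; exact: (cut_pt_inj seg t_adm).
by rewrite inE.
Qed.

Let phi b v := pole t b (node v).

Let phi_harmonic b : discrete_harmonic B cond (phi b).
Proof.
exact: (harmonic_discrete seg t_adm (@pole_continuous b) (pole_harmonic b)).
Qed.

Let poleE b x : C x -> pole t b x = interp B t (phi b) x.
Proof.
by apply: (harmonic_interp seg t_adm); [exact: pole_continuous|case: (pole_harmonic b)].
Qed.

Let phi_leaf b c : b \in B -> c \in B -> phi b c = (c == b)%:R.
Proof. by move=> bB cB; rewrite /phi /node cB pole_cut. Qed.

(** Both sides interpolate discrete harmonic functions with the same values on
    [B], so uniqueness for the discrete problem suffices. *)
Lemma poisson_formula w : {within C, continuous w} -> harmonic_on U w ->
  forall x, C x -> w x = \sum_(b in B) w (cut_pt b t) * pole t b x.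
Proof.
move=> wC wU x Cx; pose psi v := \sum_(b in B) w (cut_pt b t) * phi b v.
have psiH : discrete_harmonic B cond psi.
  move=> v vB; rewrite /flow /psi.
  rewrite (eq_bigr (fun a : edge_end => \sum_(b in B) w (cut_pt b t) *
    (cond a.1 * (phi b (end_vtx (opp_end a)) - phi b v)))); last first.
    move=> a _; rewrite -sumrB big_distrr/=; apply: eq_bigr => b _; ring.
  rewrite exchange_big big1//= => b bB; rewrite -big_distrr/=.
  by rewrite -[X in _ * X]/(flow cond (phi b) v) phi_harmonic// mulr0.
have e : w \o node =1 psi.
  apply: (discrete_uniq (conductance_gt0 seg t_adm) B_neq0).
  - exact: (harmonic_discrete seg t_adm wC wU).
  - exact: psiH.
  - move=> b bB; rewrite /psi (bigD1 b)//= phi_leaf// eqxx mulr1 big1 ?addr0.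
      by rewrite /node bB.
    by move=> c /andP[cB cb]; rewrite phi_leaf// eq_sym (negbTE cb) mulr0.
have [_ wa _] := wU; rewrite (harmonic_interp seg t_adm wC wa Cx).
rewrite (eq_bigr (fun b => w (cut_pt b t) * interp B t (phi b) x)); last first.
  by move=> b _; rewrite poleE.
case: x {Cx} => [v|f r h] /=; first by rewrite -[LHS]/((w \o node) v) e.
rewrite -![w _]/((w \o node) _) !e /psi -sumrB big_distrl/= -big_split/=.
by apply: eq_bigr => b _; ring.
Qed.

Let phi_ge0 b : b \in B -> forall v, 0 <= phi b v.
Proof.
move=> bB; apply: (discrete_min_principle (conductance_gt0 seg t_adm) B_neq0) => //.
by move=> c cB; rewrite phi_leaf// ler0n.
Qed.

Let phi_gt0 b v : b \in B -> v \notin B -> 0 < phi b v.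
Proof.
move=> bB vB; rewrite lt_neqAle phi_ge0// andbT eq_sym; apply/eqP => v0.
have leaf0 c : c \in B -> 0 <= phi b c by move=> _; exact: phi_ge0.
have := discrete_strong_min_principle (conductance_gt0 seg t_adm) B_neq0
  B_degree (@phi_harmonic b) leaf0 vB v0 b.
by rewrite phi_leaf// eqxx => /eqP; rewrite oner_eq0.
Qed.

Let lo_lt_hi e := inner_ends_lt seg t_adm e.

Let weight_itv e r : (inner_ends B e t).1 <= r <= (inner_ends B e t).2 ->
  0 <= cond e * (r - (inner_ends B e t).1) <= 1.
Proof.
move=> /andP[h1 h2]; rewrite /conductance mulrC divr_ge0 ?subr_ge0 ?(ltW (lo_lt_hi e))//=.
by rewrite ler_pdivrMr ?subr_gt0 ?lo_lt_hi// mul1r lerD2r.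
Qed.

Lemma pole_ge0 b x : b \in B -> 0 <= pole t b x.
Proof.
move=> bB; have [Cx|Cx] := pselect (C x); last first.
  by have [_ _ _ ->] := pole_dirichlet b.
rewrite poleE//; have [[v -> _]|[e [r [hr ->]]]] := closure_pt_ex seg t_adm Cx.
  exact: phi_ge0.
rewrite (interp_pt seg t_adm)//; set k := cond e * _.
have /andP[k0 k1] : 0 <= k <= 1 by exact: weight_itv.
have := phi_ge0 bB (esrc e); have := phi_ge0 bB (etgt e).
set p := phi _ _; set q := phi _ _ => p0 q0.
rewrite (_ : _ + _ = (1 - k) * q + k * p); last by ring.
by rewrite addr_ge0// mulr_ge0// subr_ge0.
Qed.

(** At a vertex this is the strong minimum principle.  Inside an edge the value
    is a proper convex combination of those at the two nodes, and one of them
    is positive. *)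
Lemma pole_gt0 b x : b \in B -> U x -> 0 < pole t b x.
Proof.
move=> bB Ux; rewrite poleE; last exact: subset_closure.
move: x Ux; apply: mgraph_case => [v /(exhaustion_vtx seg t_adm) vB|e r hr Ur].
  exact: phi_gt0.
have /andP[h1 h2] := exhaustion_ptP seg t_adm hr Ur.
rewrite (interp_pt seg t_adm)//; last by rewrite !ltW.
set k := cond e * _; have /andP[k0 k1] : 0 < k < 1.
  rewrite /k /conductance mulrC divr_gt0 ?subr_gt0 ?lo_lt_hi//=.
  by rewrite ltr_pdivrMr ?subr_gt0 ?lo_lt_hi// mul1r ltrD2r.
have := phi_ge0 bB (esrc e); have := phi_ge0 bB (etgt e).
have : 0 < phi b (esrc e) \/ 0 < phi b (etgt e).
  have [sB|sB] := boolP (esrc e \in B); last by left; exact: phi_gt0.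
  have [tB|tB] := boolP (etgt e \in B); last by right; exact: phi_gt0.
  (* An edge between two leaves is the whole graph, so [b] is one of its ends. *)
  suff /(_ b) /orP[/eqP <-|/eqP <-] : forall v, (v == esrc e) || (v == etgt e).
  - by left; rewrite phi_leaf// eqxx.
  - by right; rewrite phi_leaf// eqxx.
  apply: (@connected_closed _ _ [pred v | (v == esrc e) || (v == etgt e)] (esrc e)).
    move=> a /= /orP[/eqP ae|/eqP ae].
      by rewrite (leaf_end_uniq (B_degree sB) (a' := (e, false)) ae)// eqxx orbT.
    by rewrite (leaf_end_uniq (B_degree tB) (a' := (e, true)) ae)// eqxx.
  by rewrite /= eqxx.
set p := phi _ _; set q := phi _ _ => pq p0 q0.
rewrite (_ : _ + _ = (1 - k) * p + k * q); last by ring.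
have k1' : 0 < 1 - k by rewrite subr_gt0.
case: pq => h.
  by apply: ltr_pwDl; [exact: mulr_gt0|rewrite mulr_ge0// ltW].
by apply: ltr_wpDl; [rewrite mulr_ge0// ltW|exact: mulr_gt0].
Qed.

Lemma sum_pole x : C x -> \sum_(b in B) pole t b x = 1.
Proof.
move=> Cx; rewrite -[RHS]/((cst 1 : mgraph G -> R) x) (@poisson_formula (cst 1))//.
- by apply: eq_bigr => b _; rewrite mul1r.
- by apply: continuous_subspaceT; exact: cst_continuous.
- split; first by apply: continuous_subspaceT; exact: cst_continuous.
  + by move=> e r r' _ _ _ _; exists 0, 1 => z _; rewrite mul0r add0r.
  + move=> v _; apply: big1 => a _; apply: (@end_deriv_affine _ _ _ _ 0 1) => // r _.
    by rewrite mul0r addr0.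
Qed.

Lemma pole_le1 b x : b \in B -> pole t b x <= 1.
Proof.
move=> bB; have [Cx|Cx] := pselect (C x); last first.
  by have [_ _ _ ->//] := pole_dirichlet b; exact: ler01.
by rewrite -(sum_pole Cx) (bigD1 b)//= lerDl sumr_ge0// => c /andP[cB _]; exact: pole_ge0.
Qed.

Lemma cut_in_closure c r : c \in B -> t <= r <= s c -> C (cut_pt c r).
Proof.
move=> cB /andP[]; rewrite le_eqVlt => /orP[/eqP <- _|tr rs]; first exact: cut_closure.
by apply: subset_closure; apply: (exhaustion_cut seg t_adm) => //; rewrite tr.
Qed.

Lemma pole_cut_affine b c : c \in B ->
  exists p q, forall r, t <= r <= s c -> pole t b (cut_pt c r) = p * r + q.
Proof.
move=> cB; have [a [ac _ ccut _ clen]] := leafP (B_degree cB).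
pose e := a.1.
pose p0 := (phi b (etgt e) - phi b (esrc e)) * cond e.
pose q0 := phi b (esrc e) - p0 * (inner_ends B e t).1.
have E r : t <= r <= s c -> pole t b (cut_pt c r) =
    p0 * (if a.2 then elen e - r else r) + q0.
  move=> hr; have Cr := cut_in_closure cB hr; rewrite poleE//.
  move: Cr; rewrite ccut /end_pt => Cr.
  have hr' : 0 <= r <= elen a.1.
    case/andP: hr => h1 h2; rewrite (le_trans t_adm.1 h1) (le_trans h2)//.
    by rewrite -clen ltW// (seg_lt_len seg).
  have hz := end_coord hr'.
  rewrite (interp_pt seg t_adm); last by apply/(closure_exhaustion_pt seg t_adm).
  by rewrite /q0 /p0 /e; set z := (if _ then _ else _); ring.
case: a.2 E => E; last by exists p0, q0.
by exists (- p0), (p0 * elen e + q0) => r hr; rewrite E//; ring.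
Qed.

(** Along the terminal edge at [c] the pole is affine with values in [0, 1] on
    a segment of length [l], so its slope is at most [l^-1]. *)
Lemma pole_cut_lipschitz b c l r : b \in B -> c \in B -> 0 < l -> t + l <= s c ->
  t <= r <= s c -> `|pole t b (cut_pt c r) - (c == b)%:R| <= (r - t) / l.
Proof.
move=> bB cB l0 tl hr; have [p [q pq]] := pole_cut_affine b cB.
have ht : t <= t <= s c by rewrite lexx ltW// (t_adm.2 _ cB).
have hl : t <= t + l <= s c by rewrite lerDl ltW.
rewrite -(pole_cut bB cB) !pq// ler_pdivlMr//.
have := pole_ge0 (cut_pt c t) bB; have := pole_le1 (cut_pt c t) bB.
have := pole_ge0 (cut_pt c (t + l)) bB; have := pole_le1 (cut_pt c (t + l)) bB.
rewrite !pq// => h1 h2 h3 h4.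
have pl : `|p * l| <= 1 by rewrite ler_norml; apply/andP; split; lra.
have rt : 0 <= r - t by case/andP: hr; rewrite subr_ge0.
rewrite (_ : p * r + q - _ = p * (r - t)); last by ring.
have npl : `|p| * l = `|p * l| by rewrite normrM (ger0_norm (ltW l0)).
rewrite normrM (ger0_norm rt) mulrAC npl.
by rewrite ler_piMl.
Qed.

End FixedCut.

(** The Poisson formula on the smaller domain, applied to the pole of the
    larger one, shows that the two differ by the harmonic average of the
    differences of their values at the cut points, which are small by
    [pole_cut_lipschitz].  The estimate is uniform up to the boundary of the
    smaller domain; all the convergences below come from it. *)
Lemma pole_lipschitz t t' l b x : admissible B s t -> admissible B s t' ->
  t <= t' -> 0 < l -> (forall c, c \in B -> t + l <= s c) -> b \in B ->
  closure (exhaustion B t') x ->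
  `|pole t b x - pole t' b x| <= #|B|%:R * ((t' - t) / l).
Proof.
move=> ta ta' tt' l0 tl bB Cx.
have CC := exhaustion_le seg ta ta' tt'.
have wC : {within closure (exhaustion B t'), continuous (pole t b)}.
  exact: continuous_subspaceW CC (pole_continuous ta (b := b)).
have wU : harmonic_on (exhaustion B t') (pole t b).
  move: tt'; rewrite le_eqVlt => /orP[/eqP <-|tt']; first exact: pole_harmonic.
  apply: harmonic_onW (pole_harmonic ta b) => y Uy.
  by apply: (exhaustion_lt seg ta ta' tt'); exact: subset_closure.
have E : pole t' b x = \sum_(c in B) (c == b)%:R * pole t' c x.
  rewrite (bigD1 b)//= eqxx mul1r big1 ?addr0// => c /andP[_ /negbTE ->].
  by rewrite mul0r.
rewrite (poisson_formula ta' wC wU Cx) E -sumrB.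
apply: le_trans (ler_norm_sum _ _ _) _.
rewrite -sum1_card natr_sum big_distrl/=; apply: ler_sum => c cB.
rewrite -mulrBl normrM mul1r (ger0_norm (pole_ge0 ta' x cB)).
apply: le_trans (ler_piMr _ (pole_le1 ta' x cB)) _ => //.
apply: pole_cut_lipschitz => //; first exact: tl.
by rewrite tt' ltW// (ta'.2 _ cB).
Qed.

End Poles.

(** * Finite sums of point masses *)

Section DiracSum.
Local Open Scope ereal_scope.
Context {d : measure_display} {T : measurableType d} {R : realType}.
Context {I : finType} (J : {set I}) (w : I -> R) (p : I -> T).

Definition dirac_sum (A : set T) : \bar R :=
  \sum_(i in J) (w i)%:E * \d_(p i) A.

Lemma dirac_sumE A : dirac_sum A = (\sum_(i in J) w i * \1_A (p i))%R%:E.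
Proof. by rewrite /dirac_sum -sumEFin; apply: eq_bigr => i _; rewrite EFinM. Qed.

Hypothesis w_ge0 : forall i, i \in J -> (0 <= w i)%R.

(** Indices outside [J] get weight zero, which turns the sum into one over
    an initial segment of the natural numbers. *)
Lemma dirac_sum_measure :
  exists mu : {finite_measure set T -> \bar R}, forall A, mu A = dirac_sum A.
Proof.
have w'0 i : (0 <= if i \in J then `|w i| else 0)%R by case: ifP.
pose w' i : {nonneg R} := NngNum (w'0 i).
pose m_ (k : nat) : {measure set T -> \bar R} :=
  if insub k is Some i then mscale (w' (enum_val (i : 'I_#|I|))) \d_(p (enum_val i))
  else mzero.
have mE A : msum m_ #|I| A = dirac_sum A.
  rewrite /msum /dirac_sum [RHS]big_mkcond/= (reindex _ (onW_bij _ (enum_val_bij I)))/=.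
  apply: eq_bigr => i _; rewrite /m_ valK.
  rewrite -[LHS]/((if enum_val i \in J then `|w (enum_val i)| else 0)%R%:E * _).
  by case: ifPn => iJ; [rewrite ger0_norm// w_ge0|rewrite mul0e].
have fin : fin_num_fun (msum m_ #|I|).
  by move=> A _; rewrite mE dirac_sumE.
pose M := Measure_isFinite.Build _ _ _ (msum m_ #|I|) fin.
pose mu : {finite_measure set T -> \bar R} := HB.pack (msum m_ #|I|) M.
by exists mu => A; exact: mE.
Qed.

Hypothesis p_meas : forall i, i \in J -> measurable [set p i].
Variable m : set T -> \bar R.
Hypothesis mE : forall A, measurable A -> m A = dirac_sum A.

Import HBNNSimple.

Lemma sintegral_dirac_sum (h : {nnsfun T >-> R}) :
  sintegral m h = (\sum_(i in J) w i * h (p i))%R%:E.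
Proof.
have [mu muE] := dirac_sum_measure.
have -> : sintegral m h = sintegral mu h.
  by apply: eq_fsbigr => x _; rewrite mE// muE.
rewrite sintegralE fsbig_finite//=.
under eq_bigr do rewrite muE dirac_sumE -EFinM.
rewrite sumEFin; congr EFin.
rewrite (eq_bigr (fun x => \sum_(i in J) x * (w i * \1_(h @^-1` [set x]) (p i))))%R;
  last by move=> x _; rewrite mulr_sumr.
rewrite exchange_big/=; apply: eq_bigr => i iJ.
rewrite (bigD1_seq (h (p i)))//=; last 2 first.
- by rewrite in_fset_set// inE; exists (p i).
- exact: finmap.fset_uniq.
rewrite indicE mem_set// mulr1 mulrC big1 ?addr0// => x xh.
by rewrite indicE memNset ?mulr0// => /= e; rewrite e eqxx in xh.
Qed.

(** The maximum of the functions [f (p i)] times the indicator of [p i]; the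
    maximum, rather than the sum, allows the points to coincide. *)
Lemma nnsfun_below_interpolates (f : T -> R) : (forall x, 0 <= f x)%R ->
  exists2 h : {nnsfun T >-> R}, (forall x, h x <= f x)%R &
    forall i, i \in J -> h (p i) = f (p i).
Proof.
move=> f0; suff [h hf hl] : exists2 h : {nnsfun T >-> R},
    (forall x, h x <= f x)%R &
    forall i, i \in enum J -> h (p i) = f (p i).
  by exists h => // i iJ; apply: hl; rewrite mem_enum.
have : {subset enum J <= J} by move=> i; rewrite mem_enum.
elim: (enum J) => [_|i l IH lJ]; first by exists nnsfun0.
have [|h hf hl] := IH; first by move=> k kl; apply: lJ; rewrite inE kl orbT.
have iJ : i \in J by apply: lJ; rewrite mem_head.
pose g := scale_nnsfun (indic_nnsfun R (p_meas iJ)) (f0 (p i)).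
have gE x : g x = (f (p i) * \1_[set p i] x)%R by [].
have gf x : (g x <= f x)%R.
  rewrite gE indicE; have [/set_mem ->|_] := boolP (x \in _); first by rewrite mulr1.
  by rewrite mulr0.
exists (max_nnsfun h g) => [x|k] /=; first by rewrite ge_max hf gf.
rewrite inE => /orP[/eqP ->|/hl hk]; last by rewrite hk max_l ?gf.
have gi : g (p i) = f (p i) by rewrite gE indicE mem_set// mulr1.
have hg : (h (p i) <= g (p i))%R by rewrite gi.
exact: etrans (max_r hg) gi.
Qed.

(** The integral of a nonnegative function is a supremum over the simple
    functions below it; these are integrated by their values at the atoms, and
    one of them takes the values of [f] there.  So [D] may be any set, and the
    weighted harmonic measure is known on every set, as transporting it to the
    join requires.  As the measurable sets determine the integral, the equation
    for [m] concerns them only. *)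
Lemma integral_dirac_sum (D : set T) (f : T -> R) :
  \int[m]_(x in D) (f x)%:E =
    (\sum_(i in J) w i * (\1_D (p i) * f (p i)))%R%:E.
Proof.
have nnE (g : T -> R) : (forall x, 0 <= g x)%R ->
    ereal_sup [set sintegral m h | h in [set h : {nnsfun T >-> R} |
      forall x, (h x)%:E <= (g x)%:E]] = (\sum_(i in J) w i * g (p i))%R%:E.
  move=> g0; apply/le_anti/andP; split.
    apply: ge_ereal_sup => _ [h /= hg <-]; rewrite sintegral_dirac_sum lee_fin.
    by apply: ler_sum => i iJ; rewrite ler_wpM2l ?w_ge0// -lee_fin.
  have [h hg hp] := nnsfun_below_interpolates g0.
  apply: ereal_sup_ubound; exists h => /= [x|]; first by rewrite lee_fin.
  by rewrite sintegral_dirac_sum; congr EFin; apply: eq_bigr => i iJ; rewrite hp.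
pose g x := (\1_D x * f x)%R.
have gE : (fun x => (f x)%:E) \_ D = EFin \o g.
  apply/funext => x; rewrite patchE /= /g indicE.
  by case: ifPn; rewrite ?mul1r ?mul0r.
have pE : (EFin \o g)^\+ = EFin \o (fun x => Num.max (g x) 0%R).
  by apply/funext => x; rewrite funeposE /= -EFin_max.
have qE : (EFin \o g)^\- = EFin \o (fun x => Num.max (- g x) 0%R)%R.
  by apply/funext => x; rewrite funenegE /= -EFin_max.
rewrite /integral gE pE qE !nnE; try by move=> x; rewrite le_max lexx orbT.
rewrite -EFinB -sumrB; congr EFin; apply: eq_bigr => i _.
rewrite -mulrBr; congr (_ * _)%R; rewrite -/(g (p i)).
have [h|h] := leP (g (p i)) 0%R.
  by rewrite max_l ?oppr_ge0// sub0r opprK.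
by rewrite max_r ?subr0// oppr_le0 ltW.
Qed.

End DiracSum.

Section AtomicMeasures.
Local Open Scope ereal_scope.
Context {d : measure_display} {T : measurableType d} {R : realType}.
Context {I : finType} (J : {set I}) (p : I -> T).
Hypothesis p_inj : {in J &, injective p}.
Hypothesis p_meas : forall i, i \in J -> measurable [set p i].

Lemma sum_indic_atom (F : I -> R) i : i \in J ->
  (\sum_(k in J) F k * \1_[set p i] (p k) = F i)%R.
Proof.
move=> iJ; rewrite (bigD1 i)//= indicE mem_set// mulr1 big1 ?addr0// => k /andP[kJ ki].
by rewrite indicE memNset ?mulr0// => /= e; rewrite (p_inj kJ iJ e) eqxx in ki.
Qed.

Lemma dirac_sum_atom (w : I -> R) i : i \in J ->
  dirac_sum J w p [set p i] = (w i)%:E.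
Proof. by move=> iJ; rewrite dirac_sumE sum_indic_atom. Qed.

Lemma measurable_atoms : measurable [set p i | i in [set` J]].
Proof.
have -> : [set p i | i in [set` J]] = \bigcup_(i in [set` J]) [set p i].
  by apply/seteqP; split => x [i iJ] /= e; exists i.
by apply: fin_bigcup_measurable => // i; exact: p_meas.
Qed.

Lemma carried_by_atoms (mu : {finite_measure set T -> \bar R}) :
  mu (~` [set p i | i in [set` J]]) = 0 ->
  forall A, measurable A -> mu A = dirac_sum J (fun i => fine (mu [set p i])) p A.
Proof.
move=> mu0 A mA; pose S := [set p i | i in [set` J]].
have SE : S = \bigcup_(i in [set` J]) [set p i].
  by apply/seteqP; split => x [i iJ] /= e; exists i.
have mS : measurable S := measurable_atoms.
have -> : mu A = mu (A `&` S).
  rewrite -{1}(setUIDK A S) measureU ?setDE//; first last.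
  - by rewrite setIACA setICr setI0.
  - by apply: measurableI => //; exact: measurableC.
  - exact: measurableI.
  rewrite [X in _ + X](_ : _ = 0) ?adde0//; apply/eqP.
  rewrite -measure_le0 -mu0 le_measure ?inE//.
  - by apply: measurableI => //; exact: measurableC.
  - exact: measurableC.
rewrite SE setI_bigcupr measure_fin_bigcup//; last 2 first.
- move=> i k iJ kJ [x /= [[_ ->] [_ e]]]; exact: p_inj e.
- by move=> i iJ; apply: measurableI => //; exact: p_meas.
rewrite /dirac_sum (bigfs _ (index_enum_uniq _)); last first.
  by move=> i _; rewrite mem_index_enum.
apply: eq_fsbigr => i /set_mem /= iJ; rewrite diracE.
have [/set_mem Ap|Ap] := boolP (p i \in A).
  rewrite mule1 fineK; last by rewrite fin_num_measure//; exact: p_meas.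
  by congr (mu _); apply/setIidPr => _ ->.
rewrite mule0 (_ : _ `&` _ = set0) ?measure0//; apply/seteqP; split => // x [Ax /= xp].
by move: Ap; rewrite -xp mem_set.
Qed.

(** The integral of [F] shows that [mu] is carried by the atoms, and that of
    [f_ i] then reads off the mass of the atom [p i]. *)
Lemma atomic_of_tests (mu : {finite_measure set T -> \bar R}) (w : I -> R)
    (F : T -> R) (f_ : I -> T -> R) :
  measurable_fun setT F -> (forall x, 0 <= F x)%R ->
  (forall x, F x = 0%R -> exists2 i, i \in J & x = p i) ->
  \int[mu]_x (F x)%:E = 0 ->
  (forall i k, i \in J -> k \in J -> f_ i (p k) = (k == i)%:R) ->
  (forall i, i \in J -> \int[mu]_x (f_ i x)%:E = (w i)%:E) ->
  forall A, measurable A -> mu A = dirac_sum J w p A.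
Proof.
move=> mF F0 FS iF fp fw A mA.
have mu0 : mu (~` [set p i | i in [set` J]]) = 0.
  have mEF := iffRL (measurable_EFinP _ _) mF.
  have aF : ae_eq mu setT (EFin \o F) (cst 0).
    apply/(ae_eq_integral_abs mu measurableT mEF); rewrite -[RHS]iF.
    by apply: eq_integral => x _; rewrite gee0_abs//= lee_fin.
  apply/negligibleP; last apply: negligibleS aF.
    apply: measurableC; exact: measurable_atoms.
  move=> x /= nx /(_ Logic.I) /= [Fx0].
  by have [i iJ xi] := FS _ Fx0; apply: nx; exists i.
have muE := carried_by_atoms mu0.
rewrite muE// !dirac_sumE; congr EFin; apply: eq_bigr => i iJ; congr (_ * _)%R.
apply: EFin_inj; rewrite -fw//.
rewrite (integral_dirac_sum (w := fun i => fine (mu [set p i])) _ p_meas muE); last first.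
  by move=> k kJ; rewrite fine_ge0.
congr EFin.
rewrite (bigD1 i)//= fp// eqxx indicT mul1r mulr1 big1 ?addr0// => k /andP[kJ ki].
by rewrite fp// (negbTE ki) !mulr0.
Qed.

(** A density is determined only almost everywhere, but atoms of positive mass
    are not negligible: there it is the ratio of the masses. *)
Lemma Radon_Nikodym_atom (mu nu : {finite_measure set T -> \bar R}) (w v : I -> R) i :
  (forall k, k \in J -> 0 < w k)%R ->
  (forall A, measurable A -> mu A = dirac_sum J w p A) ->
  (forall A, measurable A -> nu A = dirac_sum J v p A) -> i \in J ->
  fine (Radon_Nikodym (charge_of_finite_measure nu) mu (p i)) = (v i / w i)%R.
Proof.
move=> w0 muE nuE iJ.
have dom : charge_of_finite_measure nu `<< mu.
  move=> N N0 A mA AN; rewrite -[LHS]/(nu A) nuE// /dirac_sum big1// => k kJ.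
  have := N0 A mA AN; rewrite muE// dirac_sumE => -[] /psumr_eq0P z.
  have /eqP := z (fun j jJ => mulr_ge0 (ltW (w0 j jJ)) (ler0n _ _)) k kJ.
  by rewrite mulf_eq0 gt_eqF ?w0//= => /eqP dk; rewrite diracE -indicE dk mule0.
have := Radon_Nikodym_integral dom (p_meas iJ).
rewrite -[LHS]/(nu [set p i]) nuE ?dirac_sum_atom//; last exact: p_meas.
set g := Radon_Nikodym _ _.
rewrite (eq_integral (fun x => (fine (g x))%:E)); last first.
  by move=> x _; rewrite fineK// Radon_Nikodym_fin_num.
rewrite (integral_dirac_sum _ p_meas muE); last by move=> k kJ; rewrite ltW// w0.
move=> -[->].
rewrite (eq_bigr (fun k => (w k * fine (g (p k))) * \1_[set p i] (p k))%R); last first.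
  by move=> k _; rewrite [(\1__ _ * _)%R]mulrC mulrA.
by rewrite sum_indic_atom// mulrC mulKf// gt_eqF// w0.
Qed.

End AtomicMeasures.

Lemma to_finite_measureE (R : realType) (T : topologicalType) (p : T)
    (m : set (Borel p) -> \bar R) (mu : {finite_measure set (Borel p) -> \bar R}) :
  (forall A, measurable A -> mu A = m A) ->
  forall A, measurable A -> to_finite_measure m A = m A.
Proof.
move=> muE; rewrite /to_finite_measure; case: pselect => [h|[]]; last by exists mu.
by case: (cid h).
Qed.

(** * Weak limits of sums of point masses *)

Section FiniteLimits.
Context {R : realType} {T : Type} (F : set_system T) {FF : Filter F}.
Context {I : finType} (J : {set I}) (f : I -> T -> R) (a : I -> R).
Hypothesis fa : forall i, i \in J -> f i x @[x --> F] --> a i.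

Lemma cvg_finsum : \sum_(i in J) f i x @[x --> F] --> \sum_(i in J) a i.
Proof. by apply: cvg_big => //; exact: add_continuous. Qed.

Lemma cvg_finprod : \prod_(i in J) f i x @[x --> F] --> \prod_(i in J) a i.
Proof. by apply: cvg_big => //; exact: mul_continuous. Qed.

End FiniteLimits.

Section BorelFacts.
Context {T : topologicalType} (p : T).

Lemma borel_open (A : set T) : open A -> measurable (A : set (Borel p)).
Proof. by move=> oA; exact: sub_sigma_algebra. Qed.

Lemma borel_closed (A : set T) : closed A -> measurable (A : set (Borel p)).
Proof.
by move=> cA; rewrite -(setCK A); apply: measurableC; apply: borel_open; exact: closed_openC.
Qed.

Lemma borel_continuous (R : realType) (f : T -> R) : continuous f ->
  measurable_fun setT (f : Borel p -> R).
Proof.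
move=> /continuousP cf; apply: (measurability _ (RGenOpens.measurableE R)).
move=> _ [_ [a [b ->] <-]]; rewrite setTI; apply: borel_open.
exact/cf/interval_open.
Qed.

Lemma borel_preimage (T' : topologicalType) (p' : T') (f : T -> T') :
  continuous f -> forall A : set (Borel p'), measurable A ->
  measurable (f @^-1` A : set (Borel p)).
Proof.
move=> /continuousP cf A mA.
have mf : measurable_fun setT (f : Borel p -> Borel p').
  apply: (@measurability _ _ (Borel p) (Borel p') setT f
    (open : set (set (at_point p')))) => //.
  by move=> _ [B oB <-]; rewrite setTI; apply: borel_open; exact: cf.
by have := mf measurableT A mA; rewrite setTI.
Qed.

End BorelFacts.

Section WeakLimits.
Context {R : realType} {T : topologicalType} (p : T).
Context {I : finType} (J : {set I}).
Local Open Scope ereal_scope.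

Lemma weak_cvg_dirac_sum (m_ : nat -> set (Borel p) -> \bar R)
    (m : set (Borel p) -> \bar R) (w_ : nat -> I -> R) (w : I -> R)
    (y_ : nat -> I -> T) (y : I -> T) :
  (forall n i, i \in J -> 0 <= w_ n i)%R -> (forall i, i \in J -> 0 <= w i)%R ->
  (forall n i, i \in J -> measurable ([set y_ n i] : set (Borel p))) ->
  (forall i, i \in J -> measurable ([set y i] : set (Borel p))) ->
  (forall n A, measurable A -> m_ n A = dirac_sum J (w_ n) (y_ n : I -> Borel p) A) ->
  (forall A, measurable A -> m A = dirac_sum J w (y : I -> Borel p) A) ->
  (forall i, i \in J -> w_ n i @[n --> \oo] --> w i) ->
  (forall i, i \in J -> y_ n i @[n --> \oo] --> y i) ->
  weak_cvg m_ m.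
Proof.
move=> w_0 w0 my_ my mE_ mE ww yy f cf.
rewrite (integral_dirac_sum w0 my mE).
under eq_fun do rewrite (integral_dirac_sum (w_0 _) (my_ _) (mE_ _)).
apply: cvg_EFin; first by near=> n.
apply: cvg_finsum => i iJ; apply: cvgM; first exact: ww.
under eq_fun do rewrite indicT mul1r.
rewrite indicT mul1r; apply: continuous_cvg; [exact: cf|exact: yy].
Unshelve. all: by end_near. Qed.

(** A finite Borel measure that integrates continuous functions like a sum of
    point masses is this sum, provided each atom is the zero set of a
    nonnegative continuous function [g i].  The test functions are products:
    that of all the [g i] vanishes exactly at the atoms, and that of the
    others, normalized at [y i], separates [y i] from the other atoms. *)
Lemma atomic_weak_limit (mu : {finite_measure set (Borel p) -> \bar R})
    (w : I -> R) (y : I -> T) (g : I -> T -> R) :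
  (forall i, i \in J -> continuous (g i)) ->
  (forall i x, i \in J -> 0 <= g i x)%R ->
  (forall i x, i \in J -> g i x = 0%R <-> x = y i) ->
  {in J &, injective y} ->
  (forall f : T -> R, continuous f ->
    \int[mu]_x (f x)%:E = (\sum_(i in J) w i * f (y i))%R%:E) ->
  forall A, measurable A -> mu A = dirac_sum J w (y : I -> Borel p) A.
Proof.
move=> cg g0 gy yinj muE.
have cp (P : {set I}) : P \subset J -> continuous (fun x => \prod_(i in P) g i x)%R.
  move=> PJ x; apply: cvg_finprod => i iP; apply: cg; exact: (fintype.subsetP PJ).
have my i : i \in J -> measurable ([set y i] : set (Borel p)).
  move=> iJ; apply: borel_closed.
  have -> : [set y i] = g i @^-1` [set 0%R].
    by apply/seteqP; split => x /= /gy; apply.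
  apply: closed_comp; first by move=> x _; exact: cg.
  exact: closed_eq.
pose N i x := (\prod_(k in J :\ i) g k x)%R.
have NJ i : J :\ i \subset J by exact: subsetDl.
apply: (@atomic_of_tests _ (Borel p) R I J y yinj my mu w
  (fun x => \prod_(k in J) g k x)%R (fun i x => N i x / N i (y i))%R) => //.
- by apply: borel_continuous; exact: cp.
- by move=> x; apply: prodr_ge0 => k; exact: g0.
- move=> x /eqP/prodf_eq0[k kJ /eqP gk]; exists k => //.
  exact/gy.
- rewrite muE; last exact: cp.
  congr EFin; apply: big1 => i iJ; rewrite (bigD1 i)//= (gy _ _ iJ).2//.
  by rewrite mul0r mulr0.
- move=> i k iJ kJ; have [->|ki] := eqVneq k i.
    rewrite divff//; apply/prodf_neq0 => l; rewrite !inE => /andP[li lJ].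
    by apply/eqP => /(gy _ _ lJ) /(yinj _ _ iJ lJ) il; rewrite il eqxx in li.
  rewrite /N (bigD1 k)/=; last by rewrite !inE ki kJ.
  by rewrite (gy _ _ kJ).2// !mul0r.
- move=> i iJ; rewrite muE; last first.
    by move=> x; apply: cvgMr_tmp; exact: (cp _ (NJ i)).
  congr EFin; rewrite (bigD1 i)//= divff; last first.
    apply/prodf_neq0 => l; rewrite !inE => /andP[li lJ].
    by apply/eqP => /(gy _ _ lJ) /(yinj _ _ iJ lJ) il; rewrite il eqxx in li.
  rewrite mulr1 big1 ?addr0// => k /andP[kJ ki].
  rewrite /N (bigD1 k)/=; last by rewrite !inE ki kJ.
  by rewrite (gy _ _ kJ).2// !mul0r mulr0.
Qed.

End WeakLimits.

(** * Sequences in the compactification and in the join *)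

Section Subsequences.
Context {R : realType} {K : topologicalType} (d : K -> K -> R).
Hypothesis d_eq0 : forall x y, d x y = 0 <-> x = y.
Hypothesis d_sym : forall x y, d x y = d y x.
Hypothesis d_triangle : forall x y z, d x z <= d x y + d y z.
Hypothesis d_nbhs : forall x (A : set K), nbhs x A <->
  exists2 e : R, 0 < e & [set y | d x y < e] `<=` A.

Lemma dist_ge0 x y : 0 <= d x y.
Proof.
have := d_triangle x y x; rewrite (d_sym y x) (d_eq0 x x).2//.
by rewrite -mulr2n pmulrn_lge0.
Qed.

Lemma dist_continuous k : continuous (d k).
Proof.
move=> x; apply/(@cvgrPdist_lt _ _ _ (d k @ x)) => e e0.
apply/d_nbhs; exists e => // y /= xy; apply: le_lt_trans xy.
rewrite ler_norml; have := d_triangle k x y; have := d_triangle k y x.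
by rewrite (d_sym y x) => *; apply/andP; split; lra.
Qed.

Lemma increasing_ge (theta : nat -> nat) : {homo theta : m n / (m < n)%N} ->
  forall n, (n <= theta n)%N.
Proof. by move=> th; elim=> // n IH; apply: leq_ltn_trans IH (th _ _ _). Qed.

Lemma increasing_cvg (theta : nat -> nat) : {homo theta : m n / (m < n)%N} ->
  theta @ \oo --> \oo.
Proof.
move=> th A [N _ NA]; exists N => // n /= Nn; apply: NA => /=.
exact: leq_trans Nn (increasing_ge th n).
Qed.

(** The sequence returns infinitely often to each ball around a cluster
    point. *)
Lemma seq_compact (y : nat -> K) : compact [set: K] ->
  exists2 theta : nat -> nat, {homo theta : m n / (m < n)%N} &
    exists k : K, y (theta n) @[n --> \oo] --> k.
Proof.
move=> cK; have [|k [_ kc]] := cK (y @ \oo) _; first exact: filterT.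
have step n N : exists m, (N < m)%N /\ d k (y m) < n.+1%:R^-1.
  have kn : nbhs k [set x | d k x < n.+1%:R^-1].
    by apply/d_nbhs; exists n.+1%:R^-1; rewrite ?invr_gt0.
  have yN : (y @ \oo) [set y m | m in [set m | (N < m)%N]].
    by exists N.+1 => // m /= Nm; exists m.
  by have [_ [[m /= Nm <-] /= km]] := kc _ _ yN kn; exists m.
have [nx nxP] := choice (fun nN => step nN.1 nN.2).
pose theta := fix th n := if n is n'.+1 then nx (n, th n') else nx (0%N, 0%N).
have thS n : (theta n < theta n.+1)%N by case: (nxP (n.+1, theta n)).
have th : {homo theta : m n / (m < n)%N}.
  by apply: homo_ltn thS => ? ? ?; exact: ltn_trans.
exists theta => //; exists k => A /d_nbhs[e e0 eA].
have thd n : d k (y (theta n)) < n.+1%:R^-1.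
  by case: n => [|n]; [case: (nxP (0%N, 0%N))|case: (nxP (n.+1, theta n))].
suff H : \forall n \near \oo, A (y (theta n)) by exact: H.
near=> n; apply: eA => /=; apply: lt_trans (thd n) _.
by near: n; exact: near_infty_natSinv_lt (PosNum e0).
Unshelve. all: by end_near. Qed.

(** Finitely many extractions, one after the other. *)
Lemma seq_compact_family (I : finType) (y : I -> nat -> K) : compact [set: K] ->
  exists2 theta : nat -> nat, {homo theta : m n / (m < n)%N} &
    exists k : I -> K, forall i, y i (theta n) @[n --> \oo] --> k i.
Proof.
move=> cK.
suff [theta th thk] : exists2 theta : nat -> nat, {homo theta : m n / (m < n)%N} &
    forall i, i \in enum I -> exists k : K, y i (theta n) @[n --> \oo] --> k.
  exists theta => //; have H i : exists x : K, y i (theta n) @[n --> \oo] --> x.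
    by apply: thk; rewrite mem_enum.
  by have [k kP] := choice H; exists k.
elim: (enum I) => [|i l [theta th thk]]; first by exists id.
have [theta' th' [k kP]] := seq_compact (y i \o theta) cK.
exists (theta \o theta') => [m n mn /=|j]; first exact/th/th'.
rewrite inE => /orP[/eqP ->|/thk[k' k'P]]; first by exists k.
exists k'; exact: cvg_comp (increasing_cvg th') k'P.
Qed.

End Subsequences.

Section Join.
Context {D K X : topologicalType} (i : D -> K) (k : D -> X).

Lemma cjoin_val_continuous : continuous (fun z : cjoin i k => \val z).
Proof. exact: initial_continuous. Qed.

Lemma cjoin_proj_continuous : continuous (@cjoin_proj D K X i k).
Proof.
move=> z; apply: (@cvg_comp _ _ _ (fun z : cjoin i k => \val z) snd _ (nbhs (\val z))).
  exact: cjoin_val_continuous.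
exact: cvg_snd.
Qed.

Lemma cjoin_fst_continuous : continuous (fun z : cjoin i k => (\val z).1).
Proof.
move=> z; apply: (@cvg_comp _ _ _ (fun z : cjoin i k => \val z) fst _ (nbhs (\val z))).
  exact: cjoin_val_continuous.
exact: cvg_fst.
Qed.

Lemma cjoin_cvg (F : set_system D) {FF : Filter F} (z : cjoin i k) :
  i @ F --> (\val z).1 -> k @ F --> (\val z).2 -> cjoin_emb i k @ F --> z.
Proof.
move=> iF kF; have ikF : (fun x => (i x, k x)) @ F --> \val z.
  rewrite [\val z]surjective_pairing; exact: cvg_pair.
move=> A; rewrite nbhsE => -[B [[W oW WB] Bz] BA].
have : nbhs (\val z) W by apply: open_nbhs_nbhs; split => //; rewrite -WB in Bz.
move=> /ikF FW; have {}FW : F [set x | W (i x, k x)] by exact: FW.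
suff H : F [set x | A (cjoin_emb i k x)] by exact: H.
by apply: filterS FW => x Wx; apply: BA; rewrite -WB.
Qed.

Lemma cjoin_limit (F : set_system D) {FF : ProperFilter F} a x :
  i @ F --> a -> k @ F --> x -> exists z : cjoin i k, \val z = (a, x).
Proof.
move=> iF kF; have ikF : (fun x => (i x, k x)) @ F --> (a, x) by exact: cvg_pair.
suff ax : cjoin_set i k (a, x) by exists (exist _ (a, x) (mem_set ax)).
move=> A /ikF FA; have {}FA : F [set y | A (i y, k y)] by exact: FA.
have [y Ay] := filter_ex FA.
by exists (i y, k y); split => //; exists y.
Qed.

End Join.

(** * Kernels as functions of the cut length *)

Lemma ratio_dist (R : realType) (a c a' c' m d : R) :
  0 <= a <= 1 -> c <= 1 -> 0 < m -> m <= c -> m <= c' ->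
  `|a' - a| <= d -> `|c' - c| <= d ->
  `|a' / c' - a / c| <= 2 * d / (m * m).
Proof.
move=> /andP[a0 a1] c1 m0 mc mc' ad cd.
have c0 : 0 < c by exact: lt_le_trans mc.
have c'0 : 0 < c' by exact: lt_le_trans mc'.
have d0 : 0 <= d by exact: le_trans ad.
have -> : a' / c' - a / c = ((a' - a) * c + a * (c - c')) / (c' * c).
  by field; rewrite !gt_eqF.
have cc0 : 0 < c' * c by exact: mulr_gt0.
rewrite normrM [X in _ * X]gtr0_norm ?invr_gt0//.
apply: ler_pM => //; [by rewrite invr_ge0 ltW| |]; last first.
  by rewrite lef_pV2 ?posrE ?mulr_gt0// ler_pM// ltW.
have -> : 2 * d = d + d by ring.
apply: le_trans (ler_normD _ _) _; apply: lerD.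
  by rewrite normrM (ger0_norm (ltW c0)); apply: le_trans ad; rewrite ler_piMr.
by rewrite normrM (ger0_norm a0) distrC; apply: le_trans cd; rewrite ler_piMl.
Qed.

Lemma clampP (R : realType) (l h r : R) : l <= h ->
  l <= Num.max l (Num.min r h) <= h.
Proof. by move=> lh; rewrite le_max lexx/= ge_max lh ge_min lexx orbT. Qed.

Lemma lipschitz_continuous (R : realType) (f : R -> R) (M : R) : 0 <= M ->
  (forall r r', `|f r - f r'| <= M * `|r - r'|) -> continuous f.
Proof.
move=> M0 fM x; apply/cvgrPdist_lt => e e0.
have M1 : 0 < M + 1 by rewrite ltr_wpDl.
have /cvgrPdist_lt xx : (fun r : R => r) @ x --> x by exact: cvg_id.
near=> r; apply: le_lt_trans (fM _ _) _.
apply: (@le_lt_trans _ _ ((M + 1) * `|x - r|)).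
  by rewrite ler_wpM2r// lerDl.
rewrite mulrC -ltr_pdivlMr//; near: r.
by apply: xx; rewrite divr_gt0.
Unshelve. all: by end_near. Qed.

Section PoleConvergence.
Context {R : realType} (G : wgraph R) (B : {set vertex G}).
Hypothesis B_neq0 : B != finset.set0.
Implicit Types (x : mgraph G) (b c v : vertex G).
Variable s : vertex G -> R.
Hypothesis seg : leaf_segments B s.
Let B_degree := seg_degree seg.

Lemma leaf_min (f : vertex G -> R) : exists2 b, b \in B & forall c, c \in B -> f b <= f c.
Proof.
have [b0 b0B] := finset.set0Pn _ B_neq0.
have [b bB bmin] := arg_minP f b0B.
by exists b.
Qed.

Lemma admissible_gap t : admissible B s t ->
  exists2 l, 0 < l & forall c, c \in B -> t + l <= s c.
Proof.
move=> [t0 ts]; have [b bB bmin] := leaf_min s; exists (s b - t).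
  by rewrite subr_gt0 ts.
by move=> c cB; rewrite addrC subrK bmin.
Qed.

(** The cut lengths stay below [sigma], and every terminal segment reaches at
    least [l] farther. *)
Variables sigma l : R.
Hypothesis sigma_gt0 : 0 < sigma.
Hypothesis l_gt0 : 0 < l.
Hypothesis sigma_l : forall c, c \in B -> sigma + l <= s c.

Lemma admissible_le t : 0 <= t <= sigma -> admissible B s t.
Proof.
move=> /andP[t0 ts]; split => // b bB.
by apply: lt_le_trans (sigma_l bB); rewrite (le_lt_trans ts)// ltrDl.
Qed.

Lemma domainE : domain B = [set x | forall b, b \in B -> 0 < leaf_dist b x].
Proof.
rewrite (domain_exhaustion seg) (exhaustionE seg)//.
by apply: admissible_le; rewrite lexx ltW.
Qed.

Lemma domain_near x : domain B x ->
  exists2 tau, 0 < tau <= sigma & exhaustion B tau x.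
Proof.
rewrite domainE => /= xD; have [b bB bmin] := leaf_min (fun b => leaf_dist b x).
exists (Num.min sigma (leaf_dist b x / 2)).
  by rewrite ge_min lexx andbT lt_min sigma_gt0 divr_gt0// xD.
have xb := xD _ bB.
rewrite (exhaustionE seg) => [c cB|]; last first.
  apply: admissible_le; rewrite ge_min lexx andbT le_min ltW//=.
  by rewrite divr_ge0// ltW.
rewrite gt_min; apply/orP; right; apply: lt_le_trans (bmin _ cB).
by rewrite ltr_pdivrMr// mulr2n mulrDr mulr1 ltrDl.
Qed.

Lemma exhaustion_mono t t' : 0 <= t <= sigma -> 0 <= t' <= sigma -> t <= t' ->
  exhaustion B t' `<=` exhaustion B t.
Proof.
move=> ht ht' tt' x; rewrite !(exhaustionE seg); try exact: admissible_le.
by move=> h b bB; apply: le_lt_trans tt' (h b bB).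
Qed.

Lemma domain_near2 x y : domain B x -> domain B y ->
  exists2 tau, 0 < tau <= sigma & exhaustion B tau x /\ exhaustion B tau y.
Proof.
move=> /domain_near[tx /andP[tx0 txs] Ux] /domain_near[ty /andP[ty0 tys] Uy].
have sub t : Num.min tx ty <= t -> 0 < t -> t <= sigma ->
    exhaustion B t `<=` exhaustion B (Num.min tx ty).
  move=> mt t0 ts; apply: exhaustion_mono => //; last by rewrite ltW.
  by rewrite (le_trans mt ts) andbT le_min !ltW.
exists (Num.min tx ty); first by rewrite lt_min tx0 ty0 ge_min txs.
by split; [apply: (sub tx)|apply: (sub ty)] => //; rewrite ge_min lexx ?orbT.
Qed.

(** [pole_lipschitz] for two cut lengths in either order, at a point that
    survives the longest cut [tau]. *)
Lemma pole_dist t t' tau b x : 0 <= t <= tau -> 0 <= t' <= tau -> tau <= sigma ->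
  b \in B -> exhaustion B tau x ->
  `|pole B t b x - pole B t' b x| <= #|B|%:R / l * `|t - t'|.
Proof.
wlog tt' : t t' / t <= t'.
  move=> H ht ht' ts bB Ux; have [tt'|tt'] := leP t t'; first exact: H.
  by rewrite distrC [`|t - t'|]distrC; apply: H => //; exact: ltW.
move=> /andP[t0 ttau] /andP[t'0 t'tau] ts bB Ux.
have ta : admissible B s t by apply: admissible_le; rewrite t0 (le_trans ttau).
have t'a : admissible B s t' by apply: admissible_le; rewrite t'0 (le_trans t'tau).
have -> : #|B|%:R / l * `|t - t'| = #|B|%:R * ((t' - t) / l).
  by rewrite distrC ger0_norm ?subr_ge0//; ring.
apply: (pole_lipschitz B_neq0 seg ta t'a tt' l_gt0) => // [c cB|].
  by apply: le_trans (sigma_l cB); rewrite lerD2r (le_trans ttau).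
apply: subset_closure; apply: exhaustion_mono Ux => //.
  by rewrite t'0 (le_trans t'tau).
by rewrite ts (le_trans t'0).
Qed.

(** The kernel of the cut-off domain based at [y], seen as a function of the
    cut length. *)
Definition pole_ratio t b y x := pole B t b x / pole B t b y.

Lemma pole_gt0_le t b x : 0 <= t <= sigma -> b \in B -> exhaustion B t x ->
  0 < pole B t b x.
Proof.
by move=> ht bB; apply: (pole_gt0 B_neq0 seg) => //; exact: admissible_le.
Qed.

Section Ratio.
Variables (tau : R) (y : mgraph G).
Hypothesis htau : 0 < tau <= sigma.
Hypothesis Uy : exhaustion B tau y.

Let tau_gt0 : 0 < tau. Proof. by case/andP: htau. Qed.
Let tau_le : tau <= sigma. Proof. by case/andP: htau. Qed.
Let sub t : 0 <= t <= tau -> 0 <= t <= sigma.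
Proof. by move=> /andP[-> h]; exact: le_trans tau_le. Qed.
Let Ut t x : 0 <= t <= tau -> exhaustion B tau x -> exhaustion B t x.
Proof.
move=> ht; apply: exhaustion_mono; [exact: sub| |by case/andP: ht].
by apply: sub; rewrite lexx ltW.
Qed.

(** The constant does not depend on the point: the denominators are bounded
    away from zero by the minimum of a positive continuous function of the cut
    length. *)
Lemma pole_ratio_lipschitz b : b \in B -> exists2 M, 0 <= M &
  forall t t' x, 0 <= t <= tau -> 0 <= t' <= tau -> exhaustion B tau x ->
  `|pole_ratio t b y x - pole_ratio t' b y x| <= M * `|t - t'|.
Proof.
move=> bB; pose k := #|B|%:R / l.
have [m m0 my] : exists2 m, 0 < m & forall t, 0 <= t <= tau -> m <= pole B t b y.
  pose f r := pole B (Num.max 0 (Num.min r tau)) b y.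
  have fc : continuous f.
    apply: (@lipschitz_continuous _ _ k); first by rewrite divr_ge0// ltW.
    move=> r r'; apply: le_trans (pole_dist (tau := tau) _ _ _ _ _) _ => //.
    - by apply: clampP; exact: ltW.
    - by apply: clampP; exact: ltW.
    - rewrite ler_wpM2l//; first by rewrite divr_ge0// ltW.
      exact: clamp_lipschitz.
  have [||c cI cmin] := @EVT_min _ f 0 tau; first exact: ltW.
    exact: continuous_subspaceT.
  exists (f c).
    apply: pole_gt0_le => //; first by apply/sub/clampP; exact: ltW.
    by apply: Ut => //; apply: clampP; exact: ltW.
  move=> t ht; have := cmin t; rewrite in_itv/= ht => /(_ isT).
  by case/andP: ht => t0 tt; rewrite {2}/f min_l// max_r.
exists (2 * k / (m * m)).
  by rewrite divr_ge0// mulr_ge0// ?divr_ge0// ltW.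
move=> t t' x ht ht' Ux; rewrite mulrAC -[2 * k * _]mulrA.
have t'a := admissible_le (sub ht').
apply: ratio_dist; rewrite ?my//.
- by rewrite (pole_ge0 B_neq0 seg)// (pole_le1 B_neq0 seg).
- exact: (pole_le1 B_neq0 seg).
- exact: (pole_dist (tau := tau)).
- exact: (pole_dist (tau := tau)).
Qed.

Lemma pole_ratio_gt0 t b x : b \in B -> 0 <= t <= tau -> exhaustion B tau x ->
  0 < pole_ratio t b y x.
Proof.
move=> bB ht Ux; rewrite divr_gt0//; apply: pole_gt0_le => //;
  by [exact: sub|exact: Ut].
Qed.

(** As the kernel is continuous in the cut length, it can be spread along the
    terminal segments.  The factor of the leaf [b] is this kernel near [b] and
    [1] at distance [tau] from [b], with a convex combination in between to
    keep it positive; near a leaf all factors but its own are [1]. *)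
Lemma pole_ratio_extension x : exhaustion B tau x -> exists f : mgraph G -> R,
  [/\ continuous f, forall z, 0 < f z &
      forall b r, b \in B -> 0 <= r <= tau / 2 ->
        f (cut_pt b r) = pole_ratio r b y x].
Proof.
move=> Ux; pose clamp r := Num.max 0 (Num.min r tau).
have clamp_tau r : 0 <= clamp r <= tau by apply: clampP; exact: ltW.
(* [1] up to [tau / 2], and [0] from [tau] on *)
pose cut r := Num.max 0 (Num.min (2 - 2 / tau * r) 1).
have cut01 r : 0 <= cut r <= 1 by exact: clampP.
pose q b r := 1 + cut r * (pole_ratio (clamp r) b y x - 1).
have q_cont b : b \in B -> continuous (q b).
  move=> bB.
  have cut_cont : continuous cut.
    have k0 : 0 <= 2 / tau by rewrite divr_ge0// ltW.
    apply: (lipschitz_continuous k0) => r r'.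
    apply: le_trans (clamp_lipschitz _ _ ltr01) _.
    rewrite -[X in _ <= X * _](ger0_norm k0).
    by rewrite -normrM distrC le_eqVlt; apply/orP; left; apply/eqP; congr `|_|; ring.
  have [M M0 HM] := pole_ratio_lipschitz bB.
  have p_cont : continuous (fun r => pole_ratio (clamp r) b y x).
    apply: (lipschitz_continuous M0) => r r'; apply: le_trans (HM _ _ _ _ _ Ux) _ => //.
    by rewrite ler_wpM2l// clamp_lipschitz.
  move=> r; apply: cvgD; first exact: cvg_cst.
  by apply: cvgM; [exact: cut_cont|apply: cvgB; [exact: p_cont|exact: cvg_cst]].
have q_gt0 b r : b \in B -> 0 < q b r.
  move=> bB; have := pole_ratio_gt0 bB (clamp_tau r) Ux.
  have := cut01 r; rewrite /q; set k := pole_ratio _ _ _ _; set c := cut r.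
  move=> /andP[c0 c1] k0; have [->|cn] := eqVneq c 0; first by rewrite mul0r addr0.
  have cp : 0 < c by rewrite lt_neqAle eq_sym cn.
  rewrite (_ : _ + _ = (1 - c) + c * k); last by ring.
  by rewrite ltr_wpDl ?subr_ge0// mulr_gt0.
exists (fun z => \prod_(b in B) q b (leaf_dist b z)); split.
- move=> z; have zF : Filter (nbhs z) := nbhs_filter z.
  apply: (@cvg_finprod _ _ (nbhs z)) => b bB.
  apply: (@continuous_cvg _ _ _ (nbhs z)); first exact: q_cont.
  exact: leaf_dist_continuous (B_degree bB) z.
- by move=> z; apply: prodr_gt0 => b; exact: q_gt0.
- move=> b r bB /andP[r0 rt].
  have rs : 0 <= r <= s b.
    rewrite r0 (le_trans rt)// (le_trans _ (sigma_l bB))//.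
    have := tau_gt0; have := tau_le; have := l_gt0; lra.
  have rtau : 0 <= r <= tau by rewrite r0 (le_trans rt)//; have := tau_gt0; lra.
  rewrite (bigD1 b)//= big1 ?mulr1 => [|c /andP[cB cb]].
    rewrite leaf_dist_cut ?B_degree//; last first.
      by rewrite r0 ltW// (le_lt_trans _ (seg_lt_len seg bB))//; case/andP: rs.
    rewrite /q; have -> : clamp r = r.
      by case/andP: rtau => _ h; rewrite /clamp min_l// max_r.
    have -> : cut r = 1; last by rewrite mul1r addrC subrK.
    rewrite /cut min_r ?max_r//.
    have : 2 / tau * r <= 1.
      by rewrite mulrAC ler_pdivrMr// mul1r; have := tau_gt0; lra.
    lra.
  have := leaf_dist_cut_other seg bB cB _ rs; rewrite eq_sym => /(_ cb) h.
  rewrite /q; have -> : cut (leaf_dist c (cut_pt b r)) = 0; last by rewrite mul0r addr0.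
  rewrite /cut max_l// ge_min; apply/orP; left; rewrite subr_le0.
  have : tau <= leaf_dist c (cut_pt b r).
    apply: le_trans (ltW h); apply: le_trans (sigma_l cB).
    by apply: le_trans tau_le _; rewrite lerDl ltW.
  by rewrite mulrAC ler_pdivlMr// => h'; rewrite ler_pM2l.
Qed.

End Ratio.

End PoleConvergence.

(** * Harmonic measures and Poisson kernels *)

Section HarmonicMeasures.
Context {R : realType} (G : wgraph R) (B : {set vertex G}).
Hypothesis B_neq0 : B != finset.set0.
Implicit Types (x : mgraph G) (b c v : vertex G).
Variable s : vertex G -> R.
Hypothesis seg : leaf_segments B s.
Let B_degree := seg_degree seg.
Variables (p0 : mgraph G) (t : R).
Hypothesis t_adm : admissible B s t.
Local Notation U := (exhaustion B t).
Local Notation T := (Borel p0).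
Local Notation cut := ((fun b => cut_pt b t) : vertex G -> T).

Lemma closed_cut b : b \in B -> closed [set cut_pt b t].
Proof.
move=> bB; have bl := B_degree bB.
have -> : [set cut_pt b t] = leaf_dist b @^-1` [set t].
  apply/seteqP; split => x /= => [->|xt].
    by rewrite leaf_dist_cut// t_adm.1 ltW// (cut_lt_len seg t_adm bB).
  by rewrite -xt cut_pt_dist// xt (cut_lt_len seg t_adm bB).
apply: closed_comp; first by move=> x _; exact: leaf_dist_continuous.
exact: closed_eq.
Qed.

Lemma measurable_cut b : b \in B -> measurable ([set cut b] : set T).
Proof. by move=> bB; apply: borel_closed; exact: closed_cut. Qed.

Lemma harmonic_measureE x (A : set T) :
  harmonic_measure U x A = dirac_sum B (fun b => pole B t b x) cut A.
Proof.
rewrite /harmonic_measure (boundary_exhaustion seg t_adm) fsbig_image/=; last first.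
  by move=> b c /set_mem bB /set_mem cB; exact: (cut_pt_inj seg t_adm).
rewrite /dirac_sum (bigfs _ (index_enum_uniq _)) => [|b _]; last first.
  by rewrite mem_index_enum.
exact: eq_fsbigr.
Qed.

Lemma harmonic_measure_finite x : exists mu : {finite_measure set T -> \bar R},
  forall A, mu A = harmonic_measure U x A.
Proof.
have [|mu muE] := @dirac_sum_measure _ T R _ B (fun b => pole B t b x) cut.
  by move=> b; exact: (pole_ge0 B_neq0 seg t_adm).
by exists mu => A; rewrite muE harmonic_measureE.
Qed.

Hypothesis Up0 : U p0.

Lemma poisson_kernelE x b : b \in B ->
  poisson_kernel p0 U x (cut_pt b t) = pole_ratio B t b p0 x.
Proof.
move=> bB; rewrite /poisson_kernel.
have hE y : forall A : set T, measurable A ->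
    to_finite_measure (harmonic_measure U y) A =
    dirac_sum B (fun b => pole B t b y) cut A.
  move=> A mA; have [mu muE] := harmonic_measure_finite y.
  by rewrite -harmonic_measureE; apply: (to_finite_measureE (mu := mu)).
apply: (@Radon_Nikodym_atom _ T R _ B cut (cut_pt_inj seg t_adm) measurable_cut
  _ _ (fun b => pole B t b p0) (fun b => pole B t b x) b) => //.
- by move=> c cB; exact: (pole_gt0 B_neq0 seg t_adm).
- exact: hE.
- exact: hE.
Qed.

Lemma weighted_harmonic_measureE (u : mgraph G -> R) (A : set T) :
  weighted_harmonic_measure u U A =
  dirac_sum B (fun b => u (cut_pt b t) * pole B t b p0) cut A.
Proof.
rewrite /weighted_harmonic_measure (@integral_dirac_sum _ T R _ B
  (fun b => pole B t b p0) cut); last first.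
- by move=> C mC; exact: harmonic_measureE.
- exact: measurable_cut.
- by move=> b bB; exact: (pole_ge0 B_neq0 seg t_adm).
rewrite dirac_sumE; congr EFin; apply: eq_bigr => b bB.
by rewrite mulrCA mulrC [pole _ _ _ _ * _]mulrC.
Qed.

End HarmonicMeasures.

(** * Boundary values and the limit of the Poisson formula *)

Section Representation.
Context {R : realType} (G : wgraph R) (B : {set vertex G}).
Hypothesis B_neq0 : B != finset.set0.
Implicit Types (x : mgraph G) (b c v : vertex G).
Variable s : vertex G -> R.
Hypothesis seg : leaf_segments B s.
Let B_degree := seg_degree seg.
Local Notation D := (domain B).

Variables (sigma l : R).
Hypothesis sigma_gt0 : 0 < sigma.
Hypothesis l_gt0 : 0 < l.
Hypothesis sigma_l : forall c, c \in B -> sigma + l <= s c.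

Variable eps : nat -> R.
Hypothesis eps_itv : forall n, 0 < eps n <= sigma.
Hypothesis eps_cvg0 : eps @ \oo --> (0 : R).

Let adm0 : admissible B s 0 := admissible0 seg.
Let eps_gt0 n : 0 < eps n. Proof. by case/andP: (eps_itv n). Qed.
Let eps_ge0 n : 0 <= eps n <= sigma.
Proof. by case/andP: (eps_itv n) => /ltW -> ->. Qed.
Let eps_adm n : admissible B s (eps n).
Proof. exact: (admissible_le l_gt0 sigma_l). Qed.

Lemma harm_domain b : b \in B -> harm D (Vtx b) = pole B 0 b.
Proof.
by move=> bB; rewrite /pole -(domain_exhaustion seg) (cut_pt0 (B_degree bB)).
Qed.

Lemma martin_kernelE y x b : b \in B ->
  martin_kernel D y x (Vtx b) = pole_ratio B 0 b y x.
Proof. by move=> bB; rewrite /martin_kernel harm_domain. Qed.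

Lemma cut_domain b n : b \in B -> D (cut_pt b (eps n)).
Proof.
move=> bB; rewrite (domain_exhaustion seg).
apply: (exhaustion_cut seg adm0 bB); rewrite eps_gt0/= ltW//.
exact: (eps_adm n).2.
Qed.

Lemma cut_cvg b : b \in B -> cut_pt b (eps n) @[n --> \oo] --> Vtx b.
Proof.
move=> bB A /nbhs_ballP[d /= d0 dA].
suff H : \forall n \near \oo, A (cut_pt b (eps n)) by exact: H.
near=> n; apply: dA; rewrite -(cut_pt0 (B_degree bB)).
apply: (path_ball_cut_pt (B_degree bB)).
- by rewrite lexx ltW// leaf_len_gt0// B_degree.
- by rewrite ltW//= ltW// (cut_lt_len seg (eps_adm n)).
- by near: n; move/cvgrPdist_lt: eps_cvg0; apply.
Unshelve. all: by end_near. Qed.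

Lemma eps_near tau : 0 < tau -> \forall n \near \oo, eps n < tau.
Proof.
move=> tau0; near=> n; have : `|0 - eps n| < tau.
  by near: n; move/cvgrPdist_lt: eps_cvg0; apply.
by rewrite sub0r normrN gtr0_norm.
Unshelve. all: by end_near. Qed.

Lemma exhaustion_domain t : admissible B s t -> exhaustion B t `<=` D.
Proof.
move=> ta x; rewrite (domain_exhaustion seg) !(exhaustionE seg)// => h b bB.
exact: le_lt_trans ta.1 (h b bB).
Qed.

Lemma pole_cvg b x : b \in B -> D x ->
  pole B (eps n) b x @[n --> \oo] --> pole B 0 b x.
Proof.
move=> bB xD; have [tau /andP[tau0 ts] Ux] := domain_near B_neq0 seg sigma_gt0 l_gt0 sigma_l xD.
apply/cvgrPdist_lt => e e0.
pose M := #|B|%:R / l; have M0 : 0 <= M by rewrite divr_ge0// ltW.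
have M1 : 0 < M + 1 by rewrite ltr_wpDl.
near=> n; have nt : eps n < tau by near: n; exact: eps_near.
have ne : eps n < e / (M + 1) by near: n; apply: eps_near; rewrite divr_gt0.
apply: le_lt_trans (pole_dist (tau := tau) B_neq0 seg l_gt0 sigma_l _ _ ts bB Ux) _.
- by rewrite lexx ltW.
- by rewrite !ltW.
rewrite sub0r normrN gtr0_norm//; rewrite ltr_pdivlMr// in ne.
by apply: le_lt_trans ne; rewrite mulrC ler_pM2l// lerDl.
Unshelve. all: by end_near. Qed.

Lemma pole_ratio_loc_unif y b : D y -> b \in B ->
  loc_unif_cvg B (fun n => pole_ratio B (eps n) b y) (pole_ratio B 0 b y).
Proof.
move=> yD bB x xD.
have [tau htau [Ux Uy]] :=
  domain_near2 B_neq0 seg sigma_gt0 l_gt0 sigma_l xD yD.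
have [tau0 taus] : 0 < tau /\ tau <= sigma by case/andP: htau.
have ta : admissible B s tau by apply: (admissible_le l_gt0 sigma_l); rewrite ltW.
have [M M0 HM] := pole_ratio_lipschitz B_neq0 seg l_gt0 sigma_l htau Uy bB.
exists (exhaustion B tau).
  by apply: open_nbhs_nbhs; split=> //; exact: (open_exhaustion seg ta).
move=> A /uniform_nbhs[E [entE EA]].
have [e /= e0 eE] := entE.
have M1 : 0 < M + 1 by rewrite ltr_wpDl.
suff H : \forall n \near \oo, A (pole_ratio B (eps n) b y) by exact: H.
near=> n; apply: EA => z [Uz _]; apply: eE => /=.
have nt : eps n < tau by near: n; exact: eps_near.
have ne : eps n < e / (M + 1) by near: n; apply: eps_near; rewrite divr_gt0.
apply: le_lt_trans (HM _ _ _ _ _ Uz) _.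
- by rewrite lexx ltW.
- by rewrite !ltW.
rewrite sub0r normrN gtr0_norm//; rewrite ltr_pdivlMr// in ne.
by apply: le_lt_trans ne; rewrite mulrC ler_pM2l// lerDl.
Unshelve. all: by end_near. Qed.

Lemma pole0_cut_cvg b c : b \in B -> c \in B ->
  pole B 0 b (cut_pt c (eps n)) @[n --> \oo] --> ((c == b)%:R : R).
Proof.
move=> bB cB; apply/cvgrPdist_lt => e e0; near=> n.
have hl : 0 + l <= s c.
  by rewrite add0r; apply: le_trans (sigma_l cB); rewrite lerDr ltW.
have hr : 0 <= eps n <= s c.
  by rewrite ltW//= ltW// ((eps_adm n).2 _ cB).
rewrite distrC; apply: le_lt_trans (pole_cut_lipschitz B_neq0 seg adm0 bB cB l_gt0 hl hr) _.
rewrite subr0 ltr_pdivrMr//; near: n; apply: eps_near; exact: mulr_gt0.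
Unshelve. all: by end_near. Qed.

Variable u : mgraph G -> R.
Hypothesis u_harmonic : harmonic_on D u.

Let uU t : admissible B s t -> harmonic_on (exhaustion B t) u.
Proof. by move=> ta; apply: harmonic_onW u_harmonic; exact: exhaustion_domain. Qed.

(** The value of [u] at the leaf itself is arbitrary; the constant term of this
    formula is the endpoint value. *)
Lemma harmonic_leaf_affine b : b \in B ->
  exists p q, forall r, 0 < r < leaf_len b -> u (cut_pt b r) = p * r + q.
Proof.
move=> bB; have [a [_ _ -> _ ->]] := leafP (B_degree bB).
have [_ ua _] := uU adm0.
have [p [q pq]] := edge_affine_open seg adm0 a.1 ua.
have {}pq r : 0 < r < elen a.1 -> u (pt a.1 r) = p * r + q.
  by move=> hr; apply: pq; rewrite /inner_ends subr0 !if_same.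
rewrite /end_pt; case: a.2; last by exists p, q.
exists (- p), (p * elen a.1 + q) => r hr.
rewrite pq; first by ring.
by case/andP: hr => h1 h2; apply/andP; split; lra.
Qed.

Lemma harmonic_endpoint b : b \in B ->
  u @ within D (nbhs (Vtx b)) --> endpoint_value B u b.
Proof.
move=> bB; have bl := B_degree bB.
have [p [q pq]] := harmonic_leaf_affine bB.
have bE : leaf_dist b (Vtx b) = 0.
  by rewrite -(cut_pt0 bl) leaf_dist_cut// lexx ltW// leaf_len_gt0.
have uq : u @ within D (nbhs (Vtx b)) --> q.
  have lc : p * leaf_dist b x + q @[x --> Vtx b] --> q.
    have E : p * leaf_dist b (Vtx b) + q = q by rewrite bE mulr0 add0r.
    rewrite -[X in _ --> X]E.
    have A : p * r + q @[r --> leaf_dist b (Vtx b)] --> p * leaf_dist b (Vtx b) + q.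
      exact: (@affine_cvg R _ (nbhs_pfilter _) p q _ cvg_id).
    exact: cvg_comp (leaf_dist_continuous bl (x := Vtx b)) A.
  apply: cvg_trans (cvg_trans (cvg_app _ (cvg_within _)) lc).
  apply: near_eq_cvg; rewrite near_withinE.
  have : \forall x \near Vtx b, leaf_dist b x < leaf_len b.
    have : leaf_dist b @ Vtx b --> leaf_dist b (Vtx b) by exact: leaf_dist_continuous.
    by move=> /cvgr_lt; apply; rewrite bE leaf_len_gt0.
  apply: filterS => x xl xD; rewrite -[in RHS](cut_pt_dist bl xl) pq// xl andbT.
  by move: xD; rewrite (domainE seg sigma_gt0 l_gt0 sigma_l) => /(_ _ bB).
have PF : ProperFilter (within D (nbhs (Vtx b))).
  apply: within_nbhs_proper; rewrite /infer (domain_exhaustion seg).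
  rewrite (closure_exhaustion seg adm0) => c cB.
  by case/andP: (leaf_dist_bounds (B_degree cB) (Vtx b)).
by rewrite /endpoint_value (cvg_lim _ uq).
Qed.

Lemma harmonic_cut_cvg b : b \in B ->
  u (cut_pt b (eps n)) @[n --> \oo] --> endpoint_value B u b.
Proof.
move=> bB; apply: cvg_comp (harmonic_endpoint bB) => A.
rewrite /within /= => /(cut_cvg bB) DA.
have {}DA : \forall n \near \oo, D (cut_pt b (eps n)) -> A (cut_pt b (eps n)).
  exact: DA.
suff H : \forall n \near \oo, A (cut_pt b (eps n)) by exact: H.
by apply: filterS DA => n; apply; exact: cut_domain.
Qed.

Lemma harmonic_poisson n x : exhaustion B (eps n) x ->
  u x = \sum_(b in B) u (cut_pt b (eps n)) * pole B (eps n) b x.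
Proof.
move=> Ux; have ea := eps_adm n.
apply: (poisson_formula B_neq0 seg ea _ (uU ea)); last exact: subset_closure.
have [uc _ _] := u_harmonic; apply: continuous_subspaceW uc.
by rewrite (domain_exhaustion seg); apply: (exhaustion_lt seg adm0 ea).
Qed.

(** The limit of the Poisson formulas of the exhausting domains: the values at
    the cut points and the poles converge separately. *)
Lemma harmonic_representation x : D x ->
  u x = \sum_(b in B) endpoint_value B u b * pole B 0 b x.
Proof.
move=> xD.
have H : \sum_(b in B) u (cut_pt b (eps n)) * pole B (eps n) b x @[n --> \oo] -->
    \sum_(b in B) endpoint_value B u b * pole B 0 b x.
  by apply: cvg_finsum => b bB; apply: cvgM; [exact: harmonic_cut_cvg|exact: pole_cvg].
have cu : (fun _ : nat => u x) @ \oo --> u x by exact: cvg_cst.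
suff H' : (fun _ : nat => u x) @ \oo -->
    \sum_(b in B) endpoint_value B u b * pole B 0 b x by exact: cvg_unique cu H'.
apply: cvg_trans H.
have [tau /andP[tau0 ts] Ux] := domain_near B_neq0 seg sigma_gt0 l_gt0 sigma_l xD.
apply: near_eq_cvg; near=> n; apply/esym/harmonic_poisson.
have nt : eps n < tau by near: n; exact: eps_near.
apply: (exhaustion_mono seg l_gt0 sigma_l (eps_ge0 n) _ (ltW nt)) Ux.
by rewrite ts ltW.
Unshelve. all: by end_near. Qed.

Lemma endpoint_ge0 : (forall x, D x -> 0 < u x) ->
  forall b, b \in B -> 0 <= endpoint_value B u b.
Proof.
move=> u0 b bB; apply: cvgr_to_ge (harmonic_cut_cvg bB) _.
by near=> n; rewrite ltW// u0//; exact: cut_domain.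
Unshelve. all: by end_near. Qed.

End Representation.

(** * Weak limits on the join *)

Section JoinLimits.
Context {R : realType} (G : wgraph R) (B : {set vertex G}).
Hypothesis B_neq0 : B != finset.set0.
Implicit Types (x : mgraph G) (b c v : vertex G).
Variable s : vertex G -> R.
Hypothesis seg : leaf_segments B s.
Let B_degree := seg_degree seg.
Local Notation D := (domain B).

Variables (sigma l : R).
Hypothesis sigma_gt0 : 0 < sigma.
Hypothesis l_gt0 : 0 < l.
Hypothesis sigma_l : forall c, c \in B -> sigma + l <= s c.

Variable eps : nat -> R.
Hypothesis eps_itv : forall n, 0 < eps n <= sigma.
Hypothesis eps_cvg0 : eps @ \oo --> (0 : R).

Let adm0 : admissible B s 0 := admissible0 seg.
Let eps_adm n : admissible B s (eps n).
Proof.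
by apply: (admissible_le l_gt0 sigma_l); case/andP: (eps_itv n) => /ltW -> ->.
Qed.

Variable x0 : D.
Local Notation p0 := (\val x0).
Hypothesis x0_inner : exhaustion B sigma p0.

Lemma base_inner n : exhaustion B (eps n) p0.
Proof.
case/andP: (eps_itv n) => e0 es.
apply: (exhaustion_mono seg l_gt0 sigma_l) x0_inner => //; first by rewrite ltW.
by rewrite lexx andbT ltW.
Qed.

Variable u : mgraph G -> R.
Hypothesis u_harmonic : harmonic_on D u.
Hypothesis u_gt0 : forall x, D x -> 0 < u x.

Definition limit_weight b : R := endpoint_value B u b * harm D (Vtx b) p0.

Definition cut_weight n b : R := u (cut_pt b (eps n)) * pole B (eps n) b p0.

Lemma cut_weight_ge0 n b : b \in B -> 0 <= cut_weight n b.
Proof.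
move=> bB; rewrite mulr_ge0 ?(pole_ge0 B_neq0 seg (eps_adm n))// ltW// u_gt0//.
exact: (cut_domain seg l_gt0 sigma_l eps_itv).
Qed.

Lemma limit_weight_ge0 b : b \in B -> 0 <= limit_weight b.
Proof.
move=> bB; rewrite /limit_weight (harm_domain seg)//.
rewrite mulr_ge0 ?(pole_ge0 B_neq0 seg adm0)//.
exact: (endpoint_ge0 seg sigma_gt0 l_gt0 sigma_l eps_itv eps_cvg0 u_harmonic).
Qed.

Lemma cut_weight_cvg b : b \in B -> cut_weight n b @[n --> \oo] --> limit_weight b.
Proof.
move=> bB; rewrite /limit_weight (harm_domain seg)//; apply: cvgM.
  exact: (harmonic_cut_cvg seg sigma_gt0 l_gt0 sigma_l eps_itv eps_cvg0 u_harmonic).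
apply: (pole_cvg B_neq0 seg sigma_gt0 l_gt0 sigma_l eps_itv eps_cvg0) => //.
by apply: (exhaustion_domain seg (eps_adm 0)); exact: base_inner.
Qed.

Variables (K : topologicalType) (i : D -> K).
Local Notation X := (mgraph G).
Local Notation k := (fun x : D => \val x).
Local Notation j := (cjoin_emb i k).
Local Notation pK := (@cjoin_proj D K X i k).
Local Notation lambda := (fun n => weighted_harmonic_measure u (exhaustion B (eps n))
  : set (Borel p0) -> \bar R).
Local Notation lambdahat := (fun n => transport j (lambda n)
  : set (Borel (j x0)) -> \bar R).

Definition cut_in_domain n b : D := insubd x0 (cut_pt b (eps n)).

Lemma cut_in_domainK n b : b \in B -> \val (cut_in_domain n b) = cut_pt b (eps n).
Proof.
move=> bB; apply: insubdK; apply/mem_set.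
exact: (cut_domain seg l_gt0 sigma_l eps_itv).
Qed.

(** Transporting a measure carried by the cut points to the join only moves
    its atoms. *)
Lemma lambdahatE n A : lambdahat n A =
  dirac_sum B (cut_weight n) (fun b => j (cut_in_domain n b) : Borel (j x0)) A.
Proof.
rewrite /transport (weighted_harmonic_measureE B_neq0 seg (eps_adm n)).
rewrite !dirac_sumE; congr EFin; apply: eq_bigr => b bB; congr (_ * _).
rewrite !indicE; congr (_%:R); congr nat_of_bool; apply/idP/idP.
  move=> /set_mem[z Az zb]; apply/mem_set; rewrite (_ : cut_in_domain n b = z)//.
  by apply: val_inj; rewrite cut_in_domainK.
by move=> /set_mem Ab; apply/mem_set; exists (cut_in_domain n b) => //; exact: cut_in_domainK.
Qed.

Variable d : K -> K -> R.
Hypothesis d_eq0 : forall x y : K, d x y = 0 <-> x = y.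
Hypothesis d_sym : forall x y : K, d x y = d y x.
Hypothesis d_triangle : forall x y z : K, d x z <= d x y + d y z.
Hypothesis d_nbhs : forall (x : K) (A : set K), nbhs x A <->
  exists2 e : R, 0 < e & [set y | d x y < e] `<=` A.
Hypothesis K_compact : compact [set: K].

(** A continuous function on the join with a single zero, the point over the
    cut point at distance [t] from the leaf [b] whose first coordinate is
    [a]. *)
Definition gap (t : R) b (a : K) (z : cjoin i k) : R :=
  d a (\val z).1 + `|leaf_dist b (pK z) - t|.

Lemma gap_ge0 t b a z : 0 <= gap t b a z.
Proof. by rewrite addr_ge0//; exact: (dist_ge0 d_eq0). Qed.

Lemma gap_continuous t b a : b \in B -> continuous (gap t b a).
Proof.
move=> bB z; have zF : Filter (nbhs z) := nbhs_filter z.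
apply: (@cvgD _ _ _ (nbhs z)).
  apply: (@continuous_cvg _ _ _ (nbhs z)); first exact: (dist_continuous d_sym d_triangle d_nbhs).
  exact: cjoin_fst_continuous.
apply: cvg_norm; apply: cvgB; last exact: cvg_cst.
apply: (@continuous_cvg _ _ _ (nbhs z)); first by apply: leaf_dist_continuous; exact: B_degree.
exact: cjoin_proj_continuous.
Qed.

Lemma gap_eq0 t b z z' : b \in B -> admissible B s t -> pK z' = cut_pt b t ->
  gap t b (\val z').1 z = 0 <-> z = z'.
Proof.
move=> bB ta z't; have bl := B_degree bB.
have lz' : leaf_dist b (pK z') = t.
  by rewrite z't leaf_dist_cut// ta.1 ltW// (cut_lt_len seg ta bB).
split=> [/eqP|->]; last first.
  by rewrite /gap (d_eq0 _ _).2// lz' subrr normr0 addr0.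
rewrite paddr_eq0 ?(dist_ge0 d_eq0)// => /andP[/eqP /d_eq0 e1].
rewrite normr_eq0 subr_eq0 => /eqP lz; apply: val_inj.
have e2 : pK z = pK z'.
  by rewrite z't -lz cut_pt_dist// lz (cut_lt_len seg ta bB).
by rewrite [LHS]surjective_pairing [RHS]surjective_pairing -e1; congr pair.
Qed.

Lemma measurable_join_point t b z : b \in B -> admissible B s t ->
  pK z = cut_pt b t -> measurable ([set z] : set (Borel (j x0))).
Proof.
move=> bB ta zt; apply: borel_closed.
have -> : [set z] = gap t b (\val z).1 @^-1` [set 0].
  by apply/seteqP; split => y /= /(gap_eq0 y bB ta zt).
apply: closed_comp; last exact: closed_eq.
by move=> y _; exact: gap_continuous.
Qed.

(** The second coordinates converge to the leaves by themselves; compactness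
    of [K] is used for the finitely many sequences of first coordinates. *)
Lemma join_limit_points (phi : nat -> nat) : {homo phi : m n / (m < n)%N} ->
  exists2 theta : nat -> nat, {homo theta : m n / (m < n)%N} &
  exists eta : vertex G -> cjoin i k, forall b, b \in B ->
    pK (eta b) = Vtx b /\ j (cut_in_domain (phi (theta n)) b) @[n --> \oo] --> eta b.
Proof.
move=> hphi.
have [theta th [a aP]] := seq_compact_family d_nbhs
  (fun b n => i (cut_in_domain (phi n) b)) K_compact.
exists theta => //.
have pt : (phi \o theta) @ \oo --> \oo.
  by apply: increasing_cvg => m n mn; exact/hphi/th.
have H b : exists z : cjoin i k, b \in B ->
    pK z = Vtx b /\ j (cut_in_domain (phi (theta n)) b) @[n --> \oo] --> z.
  have [bB|_] := boolP (b \in B); last by exists (j x0).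
  have kc : \val (cut_in_domain (phi (theta n)) b) @[n --> \oo] --> Vtx b.
    have -> : (fun n => \val (cut_in_domain (phi (theta n)) b)) =
        (fun n => cut_pt b (eps n)) \o (phi \o theta).
      by apply/funext => n; rewrite cut_in_domainK.
    exact: cvg_comp pt (cut_cvg seg l_gt0 sigma_l eps_itv eps_cvg0 bB).
  have [z zE] := @cjoin_limit D K X i k
    ((fun n => cut_in_domain (phi (theta n)) b) @ \oo) _ (a b) (Vtx b) (aP b) kc.
  exists z => _; split; first by rewrite /cjoin_proj zE.
  apply: (@cjoin_cvg D K X i k ((fun n => cut_in_domain (phi (theta n)) b) @ \oo)).
    by rewrite zE; exact: (aP b).
  by rewrite zE.
by have [eta etaP] := choice H; exists eta.
Qed.

Lemma measurable_vtx b : b \in B -> measurable ([set Vtx b] : set (Borel p0)).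
Proof.
move=> bB; rewrite -(cut_pt0 (B_degree bB)).
by apply: borel_closed; exact: (closed_cut seg adm0).
Qed.

Lemma lambda_weak_cvg (m : set (Borel p0) -> \bar R) :
  (forall A, measurable A ->
    m A = dirac_sum B limit_weight (fun b => Vtx b : Borel p0) A) ->
  weak_cvg lambda m.
Proof.
move=> mE; apply: (@weak_cvg_dirac_sum R X p0 _ B _ _ cut_weight limit_weight
  (fun n b => cut_pt b (eps n)) (fun b => Vtx b)) => //.
- exact: cut_weight_ge0.
- exact: limit_weight_ge0.
- by move=> n b bB; apply: borel_closed; exact: (closed_cut seg (eps_adm n)).
- exact: measurable_vtx.
- by move=> n A _; exact: (weighted_harmonic_measureE B_neq0 seg (eps_adm n)).
- exact: cut_weight_cvg.
- exact: (cut_cvg seg l_gt0 sigma_l eps_itv eps_cvg0).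
Qed.

Section Limit.
Variables (phi theta : nat -> nat) (eta : vertex G -> cjoin i k).
Hypothesis phi_incr : {homo phi : m n / (m < n)%N}.
Hypothesis theta_incr : {homo theta : m n / (m < n)%N}.
Hypothesis pK_eta : forall b, b \in B -> pK (eta b) = Vtx b.
Hypothesis eta_cvg : forall b, b \in B ->
  j (cut_in_domain (phi (theta n)) b) @[n --> \oo] --> eta b.

Lemma pK_eta_cut b : b \in B -> pK (eta b) = cut_pt b 0.
Proof. by move=> bB; rewrite pK_eta// cut_pt0// B_degree. Qed.

Lemma eta_inj : {in B &, injective eta}.
Proof.
by move=> b c bB cB /(congr1 pK); rewrite pK_eta// pK_eta// => -[].
Qed.

Lemma measurable_eta b : b \in B -> measurable ([set eta b] : set (Borel (j x0))).
Proof. by move=> bB; apply: (measurable_join_point bB adm0); exact: pK_eta_cut. Qed.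

Lemma lambdahat_weak_cvg (m : set (Borel (j x0)) -> \bar R) :
  (forall A, measurable A ->
    m A = dirac_sum B limit_weight (eta : vertex G -> Borel (j x0)) A) ->
  weak_cvg (lambdahat \o (phi \o theta)) m.
Proof.
move=> mE; apply: (@weak_cvg_dirac_sum R (cjoin i k) (j x0) _ B _ _
  (fun n => cut_weight (phi (theta n))) limit_weight
  (fun n b => j (cut_in_domain (phi (theta n)) b)) eta) => //.
- by move=> n; exact: cut_weight_ge0.
- exact: limit_weight_ge0.
- move=> n b bB; apply: (measurable_join_point bB (eps_adm (phi (theta n)))).
  by rewrite -cut_in_domainK.
- exact: measurable_eta.
- by move=> n A _; exact: lambdahatE.
- move=> b bB; apply: (@cvg_comp _ _ _ (phi \o theta) (fun n => cut_weight n b)).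
    by apply: increasing_cvg => m' n' mn; exact/phi_incr/theta_incr.
  exact: cut_weight_cvg.
Qed.

(** Along the further subsequence [theta] the atoms converge, so the integrals
    of a continuous function have two limits, which agree. *)
Lemma weak_limit_atomic (mhat : {finite_measure set (Borel (j x0)) -> \bar R}) :
  weak_cvg (lambdahat \o phi) mhat -> forall A, measurable A ->
  mhat A = dirac_sum B limit_weight (eta : vertex G -> Borel (j x0)) A.
Proof.
move=> mcvg; apply: (@atomic_weak_limit R (cjoin i k) (j x0) _ B mhat limit_weight
  eta (fun b => gap 0 b (\val (eta b)).1)).
- by move=> b bB; exact: gap_continuous.
- by move=> b z _; exact: gap_ge0.
- by move=> b z bB; apply: gap_eq0 => //; exact: pK_eta_cut.
- exact: eta_inj.
move=> f cf; have mh := mcvg f cf.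
have [m mE] := @dirac_sum_measure _ (Borel (j x0)) R _ B limit_weight eta limit_weight_ge0.
have mh1 := @lambdahat_weak_cvg m (fun A _ => mE A) f cf.
rewrite (@integral_dirac_sum _ (Borel (j x0)) R _ B limit_weight eta limit_weight_ge0
  measurable_eta m (fun A _ => mE A)) in mh1.
have mh2 := cvg_comp _ _ (increasing_cvg theta_incr) mh.
have -> := cvg_unique (@ereal_hausdorff R) mh2 mh1; congr EFin.
by apply: eq_bigr => b _; rewrite indicT mul1r.
Qed.

End Limit.

End JoinLimits.

(** * Martin representation on a metric graph *)

Lemma decreasing_cvg0_gt0 (R : realType) (eps : nat -> R) :
  (forall n, eps n.+1 < eps n) -> eps @ \oo --> (0 : R) -> forall n, 0 < eps n.
Proof.
move=> dec cvg0 n; apply: le_lt_trans (dec n).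
apply: cvgr_to_le cvg0 _; near=> m.
have nm : (n.+1 <= m)%N by near: m; exists n.+1.
rewrite -(subnK nm); elim: (m - n.+1)%N => [|k IH]; first by rewrite add0n.
by rewrite addSn; apply: le_trans IH; exact: ltW.
Unshelve. all: by end_near. Qed.

Theorem corollary5p9 (R : realType) (G : wgraph R) (B : {set vertex G})
    (B_neq0 : B != finset.set0)
    (B_degree : forall b, b \in B -> degree b = 1%N)
    (D_connected : connected (domain B))
    (x0 : domain B)
    (s : vertex G -> R)
    (s_gt0 : forall b, b \in B -> 0 < s b)
    (s_disjoint : forall b c, b \in B -> c \in B -> b != c ->
      terminal_seg b (s b) `&` terminal_seg c (s c) = set0)
    (s_base : forall b, b \in B -> ~ terminal_seg b (s b) (\val x0))
    (s_vertex : forall b v, b \in B -> v != b ->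
      ~ terminal_seg b (s b) (Vtx v))
    (eps : nat -> R)
    (eps_decr : forall n, eps n.+1 < eps n)
    (eps_cvg0 : eps @ \oo --> (0 : R))
    (eps_lt : forall n b, b \in B -> eps n < s b)
    (u : mgraph G -> R)
    (u_harmonic : harmonic_on (domain B) u)
    (u_gt0 : forall x, domain B x -> 0 < u x)
    (K : topologicalType) (i : domain B -> K)
    (K_compactification : compactification i)
    (K_metrizable : metrizable R K) :
  let D := domain B in
  let p0 := \val x0 in
  let Dn n := exhaustion B (eps n) in
  let cut n b : mgraph G := cut_pt b (eps n) in
  let KD := martin_kernel D p0 in
  let KDn n := poisson_kernel p0 (Dn n) in
  let j := cjoin_emb i (fun x : D => \val x) in
  let pK := @cjoin_proj D K (mgraph G) i (fun x : D => \val x) in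
  let lambda n : set (Borel p0) -> \bar R :=
    weighted_harmonic_measure u (Dn n) in
  let lambdahat n : set (Borel (j x0)) -> \bar R := transport j (lambda n) in
  [/\ exists mhat : {finite_measure set (Borel (j x0)) -> \bar R},
        subseq_weak_limit lambdahat mhat,
      forall mhat : {finite_measure set (Borel (j x0)) -> \bar R},
        subseq_weak_limit lambdahat mhat ->
        [/\ mhat (~` (pK @^-1` ideal_pts B)) = 0%E,
            forall x, D x -> (u x)%:E =
              (\int[mhat]_(eta in pK @^-1` ideal_pts B) (KD x (pK eta))%:E)%E,
            mhat [set: cjoin i (fun x : D => \val x)] = (u p0)%:E &
            {ae mhat, forall eta,
              exists (n_ : nat -> nat) (y_ : nat -> D),
              [/\ {homo n_ : k l / (k < l)%N},
                  forall k, boundary (Dn (n_ k)) (\val (y_ k)),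
                  j (y_ k) @[k --> \oo] --> (eta : cjoin i _) &
                  loc_unif_cvg B (fun k x => KDn (n_ k) x (\val (y_ k)))
                    (fun x => KD x (pK eta))]}],
      exists mu : {finite_measure set (Borel p0) -> \bar R},
        [/\ mu (~` ideal_pts B) = 0%E /\
            (forall mhat : {finite_measure set (Borel (j x0)) -> \bar R},
              subseq_weak_limit lambdahat mhat ->
              forall A, measurable A ->
                mu A = pushforward mhat (pK : Borel (j x0) -> Borel p0) A),
            (forall x, D x ->
              (u x)%:E = (\int[mu]_(b in ideal_pts B) (KD x b)%:E)%E) /\
            (forall nu : {finite_measure set (Borel p0) -> \bar R},
              nu (~` ideal_pts B) = 0%E ->
              (forall x, D x ->
                (u x)%:E = (\int[nu]_(b in ideal_pts B) (KD x b)%:E)%E) ->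
              forall A, measurable A -> nu A = mu A),
            [/\ forall b, b \in B ->
                  u @ within D (nbhs (Vtx b)) --> endpoint_value B u b,
                forall A, measurable A -> mu A =
                  (\sum_(b in B)
                    (endpoint_value B u b * harm D (Vtx b) p0)%:E *
                    \d_(Vtx b : Borel p0) A)%E &
                mu (ideal_pts B) = (u p0)%:E],
            weak_cvg lambda mu &
            forall n x, Dn n x ->
              (u x)%:E = (\int[lambda n]_(y in boundary (Dn n))
                            (KDn n x y)%:E)%E] &
      (forall b, b \in B ->
        cut n b @[n --> \oo] --> Vtx b /\
        loc_unif_cvg B (fun n x => KDn n x (cut n b))
          (fun x => KD x (Vtx b))) /\
      (forall x, D x -> exists f : mgraph G -> R,
        [/\ continuous f /\ (forall z, 0 < f z),
            \forall n \near \oo, forall b, b \in B ->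
              f (cut n b) = KDn n x (cut n b),
            forall b, b \in B -> f (Vtx b) = KD x (Vtx b) &
            let fhat := f \o pK in
            [/\ continuous fhat, forall eta, 0 < fhat eta,
                \forall n \near \oo, forall b, b \in B ->
                  exists2 z : D, \val z = cut n b &
                    fhat (j z) = KDn n x (cut n b) &
                forall eta b, b \in B -> pK eta = Vtx b ->
                  fhat eta = KD x (Vtx b)]])].
Proof.
move=> D p0 Dn cut KD KDn j pK lambda lambdahat.
have seg : leaf_segments B s by split.
have eps_gt0 := decreasing_cvg0_gt0 eps_decr eps_cvg0.
have eps_le0 n : eps n <= eps 0%N.
  by elim: n => // n IH; apply: le_trans IH; exact: ltW.
have eps_itv n : 0 < eps n <= eps 0%N by rewrite eps_gt0 eps_le0.
have adm n : admissible B s (eps n) by split; [exact: ltW|exact: eps_lt].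
have adm0 : admissible B s 0 := admissible0 seg.
have [l l_gt0 sigma_l] := admissible_gap B_neq0 (adm 0%N).
have s0 := eps_gt0 0%N.
have x0_inner : exhaustion B (eps 0%N) p0.
  rewrite (exhaustionE seg (adm 0%N)) => b bB.
  apply: lt_trans (eps_lt 0%N b bB) _; rewrite ltNge; apply/negP => h.
  by apply: (s_base b bB); rewrite (terminal_seg_s seg).
have p0D : D p0 by apply: (exhaustion_domain seg (adm 0%N)).
have p0n n : Dn n p0 by exact: (base_inner seg s0 l_gt0 sigma_l eps_itv x0_inner).
have KDE x b : b \in B -> KD x (Vtx b) = pole_ratio B 0 b p0 x.
  by move=> bB; rewrite /KD (martin_kernelE seg).
have KDnE n x b : b \in B -> KDn n x (cut n b) = pole_ratio B (eps n) b p0 x.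
  by move=> bB; rewrite /KDn (poisson_kernelE B_neq0 seg (adm n) (p0n n)).
have pole0_gt0 b x : b \in B -> D x -> 0 < pole B 0 b x.
  move=> bB xD; apply: (pole_gt0 B_neq0 seg adm0 bB).
  by rewrite -(domain_exhaustion seg).
have [[K_compact _ _ _] [d [d_eq0 d_sym d_triangle d_nbhs]]] :=
  (K_compactification, K_metrizable).
pose w b := limit_weight (B := B) x0 u b.
have wE b : b \in B -> w b = endpoint_value B u b * pole B 0 b p0.
  by move=> bB; rewrite /w /limit_weight (harm_domain seg).
have w_ge0 b : b \in B -> 0 <= w b.
  exact: (limit_weight_ge0 B_neq0 seg s0 l_gt0 sigma_l eps_itv eps_cvg0 x0
    u_harmonic u_gt0).
have repr x : D x -> u x = \sum_(b in B) endpoint_value B u b * pole B 0 b x.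
  exact: (harmonic_representation B_neq0 seg s0 l_gt0 sigma_l eps_itv eps_cvg0 u_harmonic).
have w_sum : \sum_(b in B) w b = u p0.
  by rewrite repr//; apply: eq_bigr => b bB; rewrite wE.
have w_repr x : D x -> u x = \sum_(b in B) w b * KD x (Vtx b).
  move=> xD; rewrite repr//; apply: eq_bigr => b bB.
  by rewrite wE// KDE// /pole_ratio; field; rewrite gt_eqF// pole0_gt0.
have loc b : b \in B ->
    loc_unif_cvg B (fun n x => KDn n x (cut n b)) (fun x => KD x (Vtx b)).
  move=> bB; rewrite (_ : (fun n x => _) = (fun n => pole_ratio B (eps n) b p0)).
    rewrite (_ : (fun x => _) = pole_ratio B 0 b p0); last first.
      by apply/funext => x; rewrite KDE.
    exact: (pole_ratio_loc_unif B_neq0 seg s0 l_gt0 sigma_l eps_itv eps_cvg0).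
  by apply/funext => n; apply/funext => x; rewrite KDnE.
have cutc b : b \in B -> cut n b @[n --> \oo] --> Vtx b.
  exact: (cut_cvg seg l_gt0 sigma_l eps_itv eps_cvg0).
have limits (phi : nat -> nat) : {homo phi : m n / (m < n)%N} -> _ :=
  join_limit_points seg l_gt0 sigma_l eps_itv eps_cvg0 x0 i d_nbhs K_compact (phi := phi).
(* Every weak limit sits on limits of the cut points along one subsequence, with
   weights [w] that do not depend on it. *)
have structure (mhat : {finite_measure set (Borel (j x0)) -> \bar R}) :
    subseq_weak_limit lambdahat mhat ->
    exists phi eta, [/\ {homo phi : m n / (m < n)%N},
      forall b, b \in B -> pK (eta b) = Vtx b /\
        j (cut_in_domain eps x0 (phi n) b) @[n --> \oo] --> eta b &
      forall A, measurable A ->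
        mhat A = dirac_sum B w (eta : vertex G -> Borel (j x0)) A].
  move=> [phi hphi mcvg]; have [theta th [eta etaP]] := limits phi hphi.
  exists (phi \o theta), eta; split => //; first by move=> m n mn; exact/hphi/th.
  apply: (@weak_limit_atomic _ _ _ B_neq0 _ seg _ _ s0 l_gt0 sigma_l _ eps_itv
    eps_cvg0 x0 x0_inner u u_harmonic u_gt0 K i d d_eq0 d_sym d_triangle d_nbhs
    phi theta eta hphi th) => // b bB; by case: (etaP b bB).
have meas_eta (eta : vertex G -> cjoin i (fun x : D => \val x)) :
    (forall b, b \in B -> pK (eta b) = Vtx b) ->
    forall b, b \in B -> measurable ([set eta b] : set (Borel (j x0))).
  exact: (measurable_eta seg d_eq0 d_sym d_triangle d_nbhs).
have D_open : open D.
  by rewrite /D (domain_exhaustion seg); exact: (open_exhaustion seg adm0).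
have pK_cont : continuous pK by exact: cjoin_proj_continuous.
have ideal_vtx b : b \in B -> ideal_pts B (Vtx b) by move=> bB; exists b.
split.
- have [theta th [eta etaP]] := limits id (fun m n mn => mn).
  have [mhat mE] := @dirac_sum_measure _ (Borel (j x0)) R _ B w eta w_ge0.
  exists mhat, theta => //.
  apply: (@lambdahat_weak_cvg _ _ _ B_neq0 _ seg _ _ s0 l_gt0 sigma_l _ eps_itv
    eps_cvg0 x0 x0_inner u u_harmonic u_gt0 K i d d_eq0 d_sym d_triangle d_nbhs
    id theta eta (fun m n mn => mn) th) => [b bB|b bB|A _].
  + by case: (etaP b bB).
  + by case: (etaP b bB).
  + exact: mE.
- move=> mhat /structure[phi [eta [hphi etaP mE]]].
  have pKeta b : b \in B -> pK (eta b) = Vtx b by case/etaP.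
  have meta := meas_eta eta pKeta.
  split.
  + rewrite mE; last first.
      apply: (@borel_preimage _ (j x0) _ p0 pK pK_cont (D : set (Borel p0))).
      by apply: borel_open; exact: D_open.
    rewrite dirac_sumE big1// => b bB; rewrite indicE memNset ?mulr0//=.
    by apply; rewrite pKeta//; exact: ideal_vtx.
  + move=> x xD.
    rewrite (@integral_dirac_sum _ (Borel (j x0)) R _ B w eta w_ge0 meta mhat mE).
    rewrite w_repr//; congr EFin; apply: eq_bigr => b bB.
    have eb : (pK @^-1` ideal_pts B) (eta b).
      by rewrite /preimage/= pKeta//; exact: ideal_vtx.
    by rewrite indicE mem_set// mul1r /= pKeta.
  + rewrite mE// dirac_sumE -w_sum; congr EFin.
    by apply: eq_bigr => b _; rewrite indicT mulr1.
  + exists (~` [set eta b | b in [set` B]]); split.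
    * by apply: measurableC; exact: (@measurable_atoms _ (Borel (j x0)) _ B eta meta).
    * rewrite mE; last first.
        by apply: measurableC; exact: (@measurable_atoms _ (Borel (j x0)) _ B eta meta).
      rewrite dirac_sumE big1// => b bB; rewrite indicE memNset ?mulr0//=.
      by apply; exists b.
    * move=> z /= nz [b /= bB zE]; apply: nz; rewrite -zE.
      have cutE n : \val (cut_in_domain eps x0 n b) = cut n b.
        exact: (cut_in_domainK seg l_gt0 sigma_l eps_itv).
      exists phi, (fun n => cut_in_domain eps x0 (phi n) b); split => //.
      - move=> n; rewrite cutE; exact: (cut_boundary seg (adm (phi n))).
      - by case: (etaP b bB).
      - rewrite pKeta//.
        rewrite (_ : (fun n x => _) = (fun n x => KDn (phi n) x (cut (phi n) b))).
          move=> x xD; have [N xN NU] := loc b bB x xD; exists N => //.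
          exact: (cvg_comp _ _ (increasing_cvg hphi) NU).
        by apply/funext => n; apply/funext => x; rewrite cutE.
- have [mu mE] := @dirac_sum_measure _ (Borel p0) R _ B w (fun b => Vtx b) w_ge0.
  have mvtx b : b \in B -> measurable ([set Vtx b] : set (Borel p0)).
    exact: (measurable_vtx seg).
  have mideal : measurable (ideal_pts B : set (Borel p0)).
    by apply: borel_closed; rewrite -(setCK (ideal_pts B)); exact: open_closedC.
  exists mu; split.
  + split.
      rewrite mE dirac_sumE big1// => b bB; rewrite indicE memNset ?mulr0//=.
      by apply; exact: ideal_vtx.
    move=> mhat /structure[phi [eta [hphi etaP mhE]]] A mA.
    rewrite /pushforward mhE; last exact: (@borel_preimage _ (j x0) _ p0 pK pK_cont).
    rewrite mE !dirac_sumE; congr EFin; apply: eq_bigr => b bB; congr (_ * _).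
    by rewrite !indicE; congr (_%:R); rewrite -(etaP b bB).1; congr nat_of_bool;
      apply/idP/idP => /set_mem h; apply/mem_set.
  + split.
      move=> x xD.
      rewrite (@integral_dirac_sum _ (Borel p0) R _ B w (fun b => Vtx b) w_ge0 mvtx
        mu (fun A _ => mE A)).
      rewrite w_repr//; congr EFin; apply: eq_bigr => b bB.
      by rewrite indicE mem_set ?mul1r//; exact: ideal_vtx.
    move=> nu nu0 nuE A mA.
    have vtx_inj : {in B &, injective (fun b => Vtx b : mgraph G)}.
      by move=> b c _ _ [].
    have nuA := @carried_by_atoms _ (Borel p0) R _ B (fun b => Vtx b) vtx_inj mvtx nu nu0.
    pose v b := fine (nu [set Vtx b]).
    have v_ge0 b : b \in B -> 0 <= v b by move=> _; exact: fine_ge0.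
    have uv x : D x -> u x = \sum_(b in B) v b * KD x (Vtx b).
      move=> xD; apply: EFin_inj; rewrite nuE//.
      rewrite (@integral_dirac_sum _ (Borel p0) R _ B v (fun b => Vtx b) v_ge0 mvtx
        nu nuA); congr EFin; apply: eq_bigr => b bB.
      by rewrite indicE mem_set ?mul1r//; exact: ideal_vtx.
    rewrite nuA// mE !dirac_sumE; congr EFin; apply: eq_bigr => c cB; congr (_ * _).
    have := harmonic_cut_cvg seg s0 l_gt0 sigma_l eps_itv eps_cvg0 u_harmonic cB.
    have -> : (fun n => u (cut_pt c (eps n))) =
        (fun n => \sum_(b in B) v b * KD (cut_pt c (eps n)) (Vtx b)).
      apply/funext => n; apply: uv.
      exact: (cut_domain seg l_gt0 sigma_l eps_itv).
    move=> lim1.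
    (* Along the cut points of [c], [u] tends to its endpoint value and, by its
       representation through [nu], to a multiple of the mass of [nu] at [c]. *)
    have lim2 : \sum_(b in B) v b * KD (cut_pt c (eps n)) (Vtx b) @[n --> \oo] -->
        \sum_(b in B) v b * ((c == b)%:R / pole B 0 b p0).
      apply: cvg_finsum => b bB; apply: cvgMl_tmp.
      have -> : (fun n => KD (cut_pt c (eps n)) (Vtx b)) =
          (fun n => pole B 0 b (cut_pt c (eps n)) / pole B 0 b p0).
        by apply/funext => n; rewrite KDE.
      apply: cvgMr_tmp.
      exact: (pole0_cut_cvg B_neq0 seg s0 l_gt0 sigma_l eps_itv eps_cvg0 bB cB).
    have -> : w c = (\sum_(b in B) v b * ((c == b)%:R / pole B 0 b p0)) * pole B 0 c p0.
      by rewrite wE// (norm_cvg_unique lim1 lim2).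
    rewrite (bigD1 c)//= eqxx big1 ?addr0.
      by rewrite mulrA mulr1 divfK// gt_eqF// pole0_gt0.
    by move=> b /andP[bB bc]; rewrite eq_sym (negbTE bc) mul0r mulr0.
  + split.
    * exact: (harmonic_endpoint seg s0 l_gt0 sigma_l u_harmonic).
    * by move=> A _; exact: mE.
    * rewrite mE dirac_sumE -w_sum; congr EFin; apply: eq_bigr => b bB.
      by rewrite indicE mem_set ?mulr1//; exact: ideal_vtx.
  + apply: (lambda_weak_cvg B_neq0 seg s0 l_gt0 sigma_l eps_itv eps_cvg0 x0_inner
      u_harmonic u_gt0) => A _; exact: mE.
  + move=> n x Ux.
    have mcut b : b \in B -> measurable ([set cut n b] : set (Borel p0)).
      by move=> bB; apply: borel_closed; exact: (closed_cut seg (adm n)).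
    have cw_ge0 b : b \in B -> 0 <= cut_weight eps x0 u n b.
      exact: (cut_weight_ge0 B_neq0 seg l_gt0 sigma_l eps_itv).
    have lambdaE (A : set (Borel p0)) : measurable A ->
        lambda n A =
          dirac_sum B (cut_weight eps x0 u n) (cut n : vertex G -> Borel p0) A.
      by move=> _; exact: (weighted_harmonic_measureE B_neq0 seg (adm n)).
    rewrite (@integral_dirac_sum _ (Borel p0) R _ B _ (cut n) cw_ge0 mcut _ lambdaE).
    rewrite (harmonic_poisson B_neq0 seg l_gt0 sigma_l eps_itv u_harmonic Ux).
    congr EFin; apply: eq_bigr => b bB.
    rewrite indicE mem_set; last exact: (cut_boundary seg (adm n)).
    rewrite mul1r KDnE// /cut_weight /pole_ratio; field; rewrite gt_eqF//.
    exact: (pole_gt0 B_neq0 seg (adm n) bB (p0n n)).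
- split.
  + by move=> b bB; split; [exact: cutc|exact: loc].
  + move=> x xD.
    have [tau htau [Ux Uy]] := domain_near2 B_neq0 seg s0 l_gt0 sigma_l xD p0D.
    have [f [fc f0 fE]] := pole_ratio_extension B_neq0 seg l_gt0 sigma_l htau Uy Ux.
    have tau0 : 0 < tau by case/andP: htau.
    have f_cut : \forall n \near \oo, forall b, b \in B ->
        f (cut n b) = KDn n x (cut n b).
      have : \forall n \near \oo, eps n < tau / 2.
        by apply: (eps_near eps_itv eps_cvg0); rewrite divr_gt0.
      by apply: filterS => n nt b bB; rewrite KDnE// fE// !ltW.
    have f_vtx b : b \in B -> f (Vtx b) = KD x (Vtx b).
      move=> bB; rewrite KDE// -(cut_pt0 (B_degree b bB)) fE// lexx/=.
      by rewrite divr_ge0// ltW.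
    exists f; split => //; split.
    * by move=> z; apply: continuous_comp; [exact: pK_cont|exact: fc].
    * by move=> z; exact: f0.
    * apply: filterS f_cut => n fn b bB.
      exists (cut_in_domain eps x0 n b).
        exact: (cut_in_domainK seg l_gt0 sigma_l eps_itv).
      rewrite /= /pK /cjoin_proj/= (cut_in_domainK seg l_gt0 sigma_l eps_itv)//.
      exact: fn.
    * by move=> z b bB /= ->; exact: f_vtx.
Qed.
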